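(* Let $L$ be an $\ell\times\ell$ monic linear pencil in $\mathbb{R}^{\ell\times\ell}\langle x,x^*\rangle$. (1) $\deg\delta_n\ge\deg(\mathcal D_L(n))\ge n\deg\delta_1$. (2) Suppose $\delta_1$ is a minimum degree defining polynomial for $\mathcal D_L(1)$. If $\deg\delta_1=\ell$, then $\deg(\mathcal D_L(n))=n\deg\delta_1$ and $\delta_n$ is a minimum degree defining polynomial for $\mathcal D_L(n)$ for every $n$, so $\mathcal Z(\widehat{\partial\mathcal D}_L^\circ)=V(L)$. (3) If $\mathcal D_L$ is the free ball, i.e. $\ell=g+1$ and $L$ is the matrix with $1$'s on the diagonal, first row $(1,x_1^*,x_2^*,\dots,x_g^* )$, first column $(1,x_1,\dots,x_g)^T$, and all other entries $0$, then $\deg(\mathcal D_L(n))=n\deg\delta_1$ and $\delta_n$ is a minimum degree defining polynomial for $\mathcal D_L(n)$ for every $n$, so $\mathcal Z(\widehat{\partial\mathcal D}_L^\circ)=V(L)$.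
   Context: Let $x=(x_1,\dots,x_g)$ and let $\mathbb{R}\langle x,x^*\rangle$ be the free real algebra on the $2g$ noncommuting letters $x_i,x_i^*$, with the linear involution $*$ exchanging $x_i$ and $x_i^*$ and satisfying $(pq)^*=q^*p^*$. A matrix polynomial $p=\sum_wA_w\otimes w$ has $p^*=\sum_wA_w^*\otimes w^*$ ($A^*$ = transpose) and is evaluated at a tuple $X$ of real $n\times n$ matrices by $p(X)=\sum_wA_w\otimes w(X)$ (Kronecker product), with $x_i\mapsto X_i$, $x_i^*\mapsto X_i^*$ (transpose), empty word $\mapsto\mathrm{Id}_n$. A monic linear pencil is $L=L^*\in\mathbb{R}^{\ell\times\ell}\langle x,x^*\rangle$ of degree at most $1$ with $L(0)=\mathrm{Id}_\ell$. $\mathcal D_L(n)=\{X\in(\mathbb{R}^{n\times n})^g: L(X)\succeq0\}$, $\mathcal D_L=\bigcup_n\mathcal D_L(n)$; $\delta_n(X)=\det L(X)$ for $X\in(\mathbb{R}^{n\times n})^g$, viewed as a commutative polynomial in the $gn^2$ entries of $X$ (so $\delta_1$ is a polynomial on $\mathbb{R}^g$). Here $n$ is an arbitrary positive integer. For a commutative polynomial $p$ on $\mathbb{R}^m$ with $p(0)>0$, $\mathcal C_p$ is the closure of the connected component of $0$ in $\{p>0\}$. A minimum degree defining polynomial for a set $\mathcal C=\mathcal C_p$ is a polynomial $\tilde p$ of lowest degree with $\mathcal C=\mathcal C_{\tilde p}$; its degree is denoted $\deg(\mathcal C)$. This applies to $\mathcal D_L(n)=\mathcal C_{\delta_n}\subseteq(\mathbb{R}^{n\times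 n})^g$. $\mathcal D_L^\circ(n)$ is the principal component (connected component of $0$) of $\{X\in(\mathbb{R}^{n\times n})^g:L(X)\succ0\}$, $\mathcal D_L^\circ=\bigcup_n\mathcal D_L^\circ(n)$, and $\widehat{\partial\mathcal D}_L^\circ=\{(X,v):X\in\overline{\mathcal D_L^\circ},\ L(X)v=0\}$ (closure for each $n$; $v\in\mathbb{R}^{\ell n}$). $V(L)=\{(X,v):L(X)v=0\}$ (over all $n$). For $W\subseteq\bigcup_n(\mathbb{R}^{n\times n})^g\times\mathbb{R}^{\ell n}$, $\mathcal I(W)=\{p\in\mathbb{R}^{1\times\ell}\langle x,x^*\rangle:p(X)v=0\ \forall(X,v)\in W\}$ and $\mathcal Z(W)=\{(X,v):p(X)v=0\ \forall p\in\mathcal I(W)\}$.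
   Formalization: In (1), deg(D_L(n)) ≥ n deg δ_1 is proved only when δ_1 is a minimum degree defining polynomial for D_L(1) (it fails for L = I_2(1+x+x* ), n=1); without that hypothesis deg(D_L(n)) ≥ n deg(D_L(1)) is proved instead. *)

(* Defs.v *)
From mathcomp Require Import all_boot all_order all_algebra.
From mathcomp Require Import finmap mxtens monalg mpoly.
From mathcomp Require Import all_classical all_reals all_analysis.

Set Implicit Arguments.
Unset Strict Implicit.
Unset Printing Implicit Defensive.

Import Order.TTheory GRing.Theory Num.Theory numFieldNormedType.Exports.

Local Open Scope classical_set_scope.
Local Open Scope ring_scope.

(* [(i, false)] is the letter x_i and [(i, true)] is the letter x_i^*. *)
Notation letter g := ('I_g * bool)%type.
Notation word g := {fmonom letter g}.

Definition word_star (g : nat) (w : word g) : word g :=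
  FMonom [seq (a.1, ~~ a.2) | a <- rev w].

(* R^{k x l}<x,x^*>, as finitely supported families of coefficient matrices
   A_w indexed by the words w. The operations of monalg are qualified because
   mpoly reuses their names; conversely, commutative polynomials are written
   [mpoly m R] because monalg overloads the usual notation. *)
Notation mxncpoly R k l g := {malg 'M[R]_(k, l)[word g]}.

Definition mxnc_star (R : nzRingType) (k l g : nat) (p : mxncpoly R k l g) :
    mxncpoly R l k g :=
  \sum_(w <- monalg.msupp p)
     monalg.mkmalgU (word_star w) (monalg.mcoeff w p)^T.

(* (T^{n x n})^g, as the affine space of row vectors of length g n^2;
   [mxtuple X i] is the i-th matrix of the tuple X. *)
Notation mxpoint T g n := 'rV[T]_(g * (n * n)).

Definition mxtuple (T : Type) (g n : nat) (X : mxpoint T g n) (i : 'I_g) :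
    'M[T]_n :=
  vec_mx (row i (vec_mx X)).

Definition letter_eval (T : Type) (g n : nat) (X : mxpoint T g n)
    (a : letter g) : 'M[T]_n :=
  if a.2 then (mxtuple X a.1)^T else mxtuple X a.1.

Definition word_eval (S : nzRingType) (g n : nat) (X : mxpoint S g n)
    (w : word g) : 'M[S]_n :=
  foldr (fun a M => letter_eval X a *m M) 1%:M w.

(* p(X) for X with entries in an extension f : R -> S of the coefficient ring,
   so that p can also be evaluated at the generic tuple. *)
Definition mxnc_eval_in (R S : nzRingType) (f : R -> S) (k l g n : nat)
    (p : mxncpoly R k l g) (X : mxpoint S g n) : 'M[S]_(k * n, l * n) :=
  \sum_(w <- monalg.msupp p)
     tensmx (map_mx f (monalg.mcoeff w p)) (word_eval X w).

Definition mxnc_eval (R : nzRingType) (k l g n : nat)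
    (p : mxncpoly R k l g) (X : mxpoint R g n) : 'M[R]_(k * n, l * n) :=
  mxnc_eval_in id p X.

Definition monic_pencil (R : nzRingType) (l g : nat) (L : mxncpoly R l l g)
    : Prop :=
  [/\ mxnc_star L = L,
      (forall w : word g, w \in monalg.msupp L -> (fdeg w <= 1)%N) &
      mxnc_eval L (0 : mxpoint R g 1) = 1%:M].

(* delta_n: the determinant of L at the tuple of generic n x n matrices. *)
Definition pencil_det (R : comNzRingType) (l g : nat) (L : mxncpoly R l l g)
    (n : nat) : mpoly (g * (n * n)) R :=
  \det (mxnc_eval_in (@mpolyC _ R) L (\row_s 'X_s)).

Definition free_ball_pencil (R : nzRingType) (g : nat) :
    mxncpoly R g.+1 g.+1 g :=
  monalg.mkmalgU (FMonom [::]) 1%:M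
  + \sum_(i < g) monalg.mkmalgU (FMonom [:: (i, true)])
                   (delta_mx ord0 (lift ord0 i))
  + \sum_(i < g) monalg.mkmalgU (FMonom [:: (i, false)])
                   (delta_mx (lift ord0 i) ord0).

Section AlgebraicInterior.
Variables (R : realType) (m : nat).

Definition mpoly_at (p : mpoly m R) (x : 'rV[R]_m) : R :=
  p.@[fun s => x ord0 s].

(* Total degree, with degree 0 for the zero polynomial. *)
Definition tdeg (p : mpoly m R) : nat := (msize p).-1.

Definition alg_interior_closure (p : mpoly m R) : set 'rV[R]_m :=
  closure (connected_component [set x | 0 < mpoly_at p x] 0).

Definition defining_poly (C : set 'rV[R]_m) (p : mpoly m R) : Prop :=
  0 < mpoly_at p 0 /\ C = alg_interior_closure p.

Definition min_degree_defining_poly (C : set 'rV[R]_m) (p : mpoly m R)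
    : Prop :=
  defining_poly C p /\
  forall q : mpoly m R, defining_poly C q -> (tdeg p <= tdeg q)%N.

(* deg(C); the value 0 is a default for sets C without defining polynomial.
   For a pencil set this can be less than the degree of its determinant: if
   L is 1 + x + x^* times the 2 x 2 identity matrix, then deg delta_1 = 2 and
   deg(D_L(1)) = 1.
   Hence n deg(delta_1) bounds deg(D_L(n)) from below for all n only if
   delta_1 has minimum degree; n deg(D_L(1)) always does. *)
Definition set_deg (C : set 'rV[R]_m) : nat :=
  xget 0%N [set d | exists2 p, min_degree_defining_poly C p & d = tdeg p].

End AlgebraicInterior.

Definition psdmx (R : numDomainType) (N : nat) (A : 'M[R]_N) : Prop :=
  A^T = A /\ forall v : 'cV[R]_N, 0 <= (v^T *m A *m v) ord0 ord0.

Definition pdmx (R : numDomainType) (N : nat) (A : 'M[R]_N) : Prop :=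
  A^T = A /\
  forall v : 'cV[R]_N, v != 0 -> 0 < (v^T *m A *m v) ord0 ord0.

Section PencilSets.
Variables (R : realType) (l g : nat).

(* Subsets W of the union over n of (R^{n x n})^g x R^{l n}, given level by
   level; only the levels n > 0 are meaningful. *)
Definition pointvec_sets : Type :=
  forall n : nat, set (mxpoint R g n * 'cV[R]_(l * n)).

Implicit Type L : mxncpoly R l l g.

Definition pencil_set L (n : nat) : set (mxpoint R g n) :=
  [set X | psdmx (mxnc_eval L X)].

Definition pencil_interior L (n : nat) : set (mxpoint R g n) :=
  connected_component [set X | pdmx (mxnc_eval L X)] 0.
Arguments pencil_interior : clear implicits.

Definition detailed_boundary L : pointvec_sets :=
  fun n => [set Xv | closure (pencil_interior L n) Xv.1
                     /\ mxnc_eval L Xv.1 *m Xv.2 = 0].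

Definition pencil_zeros L : pointvec_sets :=
  fun n => [set Xv | mxnc_eval L Xv.1 *m Xv.2 = 0].

Definition vanishing_ideal (W : pointvec_sets) : set (mxncpoly R 1 l g) :=
  [set p | forall n (X : mxpoint R g n) v, (0 < n)%N -> W n (X, v) ->
     mxnc_eval p X *m v = 0].

Definition zero_closure (W : pointvec_sets) : pointvec_sets :=
  fun n => [set Xv | forall p, vanishing_ideal W p ->
     mxnc_eval p Xv.1 *m Xv.2 = 0].

End PencilSets.

Arguments pencil_set {R l g} L n _.
Arguments pencil_interior {R l g} L n _.
Arguments detailed_boundary {R l g} L n _.
Arguments pencil_zeros {R l g} L n _.
Arguments zero_closure {R l g} W n _.

(* Main.v *)
Require Import Defs.
From HB Require Import structures.
From mathcomp Require Import all_boot all_order all_algebra.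
From mathcomp Require Import finmap mxtens monalg mpoly.
From mathcomp Require Import all_classical all_reals all_analysis.
From mathcomp Require Import perm ring lra.
Import Order.TTheory GRing.Theory Num.Theory numFieldNormedType.Exports.
Local Open Scope classical_set_scope.
Local Open Scope ring_scope.

Set Implicit Arguments.
Unset Strict Implicit.
Unset Printing Implicit Defensive.

(** Write D(n) for the set of tuples X of n x n matrices with L(X) positive
    semidefinite, delta_n for det L, and call a point of D(n) a boundary point
    if delta_n vanishes there.

    Geometry. As L(tX) = (1 - t) Id + t L(X), the set {L > 0} is star-shaped
    about 0 and its closure is D(n). It is open, and if h = 0 on the boundary
    points, it is also closed in {h > 0}. So every polynomial that is positive
    on {L > 0} and zero on the boundary points defines D(n)
    ([defining_poly_of_pos]); delta_n is one. Conversely, every defining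
    polynomial vanishes on the boundary points, because (1 + s) z leaves D(n)
    for every boundary point z and every s > 0 ([defining_poly_boundary]).

    Divisibility. If f vanishes on the boundary points, then so does the gcd h
    of delta_n and f ([vanishing_common_factor]). Write delta_n = a h and
    f = b h. If h did not vanish at a boundary point z, then a and b would
    vanish at all the boundary points near z. Every line in the direction of z
    that passes near z contains such a point, as it goes from {L > 0} to the
    complement of D(n). Eliminating the coordinate along z from the coprime a
    and b gives a nonzero polynomial that vanishes at every y for which the
    line through y in the direction of z meets the common zeros of a and b,
    hence on an open set: a contradiction. The elimination uses that coprime
    polynomials stay coprime over the fraction field of the other variables,
    that is, unique factorization in polynomial rings ([factorial_mpoly],
    [coprime_elimination]). As h divides delta_n, it has constant sign on
    {L > 0}, so a multiple of h defines D(n). Two consequences follow. A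
    nonzero polynomial that vanishes on the boundary points has degree at least
    deg D(n). If delta_n has minimal degree, it divides every such polynomial.

    Lower bound. Restrict a defining polynomial of D(n) to tuples of diagonal
    matrices, that is, to n points of R^g. There L is the direct sum of its
    values at the n points, so the restriction vanishes as soon as one of the
    points is a boundary point of D(1) and the others are near 0; being
    polynomial in the others, it vanishes for all values of the others. Taking
    the coefficient of a suitable monomial in the coordinates of one point
    removes this point and lowers the degree by at least deg D(1)
    ([block_degree_step]). Hence the degree is at least n deg D(1)
    ([defining_degree_lower_bound]).

    Equality. If all defining polynomials of D(1) have degree at least d, and
    deg delta_n <= n d, everything is sharp ([sharp_degree_bound]). In a pencil
    of size l, delta_n is the determinant of a matrix of size n l with entries
    of degree at most 1. For the free ball, only the first block row and the
    first block column are not constant, so deg delta_n <= 2 n, while the line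
    through a coordinate vector meets the boundary of D(1) on both sides of 0,
    so d = 2.

    Zeros. Suppose that delta_n has minimal degree and that p vanishes on the
    detailed boundary. The columns of the adjugate of L(X) lie in the kernel of
    L(X) at boundary points, so p adj(L) vanishes there and is divisible by
    delta_n: p adj(L) = delta_n Q. Multiplying by L gives p = Q L over the
    commutative polynomials ([vanishing_ideal_left_multiple]), so p(X) v = 0
    whenever L(X) v = 0. *)

(** * Unique factorization in polynomial rings *)

Definition divides (A : comNzRingType) (a b : A) : Prop := exists c, b = c * a.

Definition prime_elt (A : idomainType) (p : A) : Prop :=
  [/\ p != 0, p \isn't a GRing.unit &
      forall a b, divides p (a * b) -> divides p a \/ divides p b].

(** The function nu plays the role of the number of prime factors. Asking for
    it, instead of for factorizations, gives a measure for inductions and is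
    inherited by polynomial rings; with the prime divisors it amounts to unique
    factorization. *)
Definition factorial_domain (A : idomainType) : Prop :=
  (exists nu : A -> nat,
     (forall a b, a != 0 -> b != 0 -> nu (a * b) = (nu a + nu b)%N) /\
     (forall a, a != 0 -> nu a = 0%N -> a \is a GRing.unit)) /\
  (forall a : A, a != 0 -> a \isn't a GRing.unit ->
     exists2 p, prime_elt p & divides p a).

Lemma divides_trans (A : comNzRingType) (a b c : A) :
  divides a b -> divides b c -> divides a c.
Proof. by move=> [x ->] [y ->]; exists (y * x); rewrite mulrA. Qed.

Lemma divides_mull (A : comNzRingType) (a b c : A) :
  divides a b -> divides a (c * b).
Proof. by move=> [x ->]; exists (c * x); rewrite mulrA. Qed.

Lemma divides_mulr (A : comNzRingType) (a b c : A) :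
  divides a b -> divides a (b * c).
Proof. by rewrite mulrC; apply: divides_mull. Qed.

(** Gauss's lemma. By induction on both polynomials: p divides the product of
    the two constant terms, so it divides one of them, and that term can be
    dropped. *)
Lemma prime_dvd_const_mul (A : idomainType) (p : A) (Q G : {poly A}) :
  prime_elt p -> divides p%:P (Q * G) -> divides p%:P Q \/ divides p%:P G.
Proof.
case=> p0 pU pP; have pP0 : p%:P != 0 by rewrite polyC_eq0.
have dvdC (c : A) : divides p c -> divides p%:P c%:P.
  by case=> d ->; exists d%:P; rewrite polyCM.
have dvdX (H : {poly A}) : divides p%:P (H * 'X) -> divides p%:P H.
  case=> K /polyP eK; exists (\poly_(i < size K) K`_i.+1).
  apply/polyP=> i; have := eK i.+1; rewrite coefMX /= coefMC => ->.
  rewrite coefMC coef_poly; case: ltnP => // h.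
  by rewrite nth_default // ltnW.
have dvd0 (H K : {poly A}) (c d : A) :
    divides p%:P ((H * 'X + c%:P) * (K * 'X + d%:P)) -> divides p (c * d).
  case=> U /polyP /(_ 0%N); rewrite coefMC => e; exists U`_0.
  by rewrite -e coefM big_ord1 !coefD !coefMX !coefC /= !add0r.
have dvdB (H K : {poly A}) : divides p%:P (H + K) -> divides p%:P K ->
    divides p%:P H.
  by move=> [U eU] [V eV]; exists (U - V); rewrite mulrBl -eU -eV addrK.
have dvdD (H K : {poly A}) : divides p%:P H -> divides p%:P K ->
    divides p%:P (H + K).
  by move=> [U ->] [V ->]; exists (U + V); rewrite mulrDl.
elim/poly_ind: Q G => [|Q q IHQ] G.
  by move=> _; left; exists 0; rewrite mul0r.
elim/poly_ind: G => [|G g IHG] h; first by right; exists 0; rewrite mul0r.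
case: (pP _ _ (dvd0 _ _ _ _ h)) => [/dvdC dq|/dvdC dg].
  move: h; rewrite mulrDl => /dvdB /(_ (divides_mulr _ dq)).
  rewrite mulrAC => /dvdX /IHQ [dQ|]; last by right.
  by left; apply: dvdD => //; apply: divides_mulr.
move: h; rewrite mulrDr => /dvdB /(_ (divides_mull _ dg)).
rewrite mulrA => /dvdX /IHG [|dG]; first by left.
by right; apply: dvdD => //; apply: divides_mulr.
Qed.

Lemma prime_polyC (A : idomainType) (p : A) : prime_elt p -> prime_elt p%:P.
Proof.
move=> pp; case: (pp) => p0 pU _; split.
- by rewrite polyC_eq0.
- by rewrite poly_unitE coefC eqxx negb_and pU orbT.
- by move=> Q G; apply: prime_dvd_const_mul.
Qed.

(** The prime factors of k divide Q or G. Cancelling them one by one takes from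
    G only the constant c. *)
Lemma cancel_const (A : idomainType) (k : A) (F Q G : {poly A}) :
  factorial_domain A -> k != 0 -> k *: F = Q * G ->
  exists c, exists2 G', c != 0 /\ G = c *: G' & divides G' F.
Proof.
move=> [[nu [nuM nuU]] pdiv].
elim: {k}(nu k).+1 {-2}k (ltnSn (nu k)) Q G => // n IHn k kn Q G k0 e.
have [kU|kU] := boolP (k \is a GRing.unit).
  exists 1, G; first by rewrite oner_neq0 scale1r.
  by exists (k^-1 *: Q); rewrite -scalerAl -e scalerA mulVr // scale1r.
have [p pp [k' ek]] := pdiv k k0 kU; have [p0 pU _] := pp.
have k'0 : k' != 0 by apply: contraNneq k0 => h; rewrite ek h mul0r.
have k'n : (nu k' < n)%N.
  move: kn; rewrite ltnS ek nuM // => /(leq_trans _); apply.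
  by rewrite -[X in (X < _)%N]addn0 ltn_add2l lt0n; apply: contra pU => /eqP /nuU ->.
have pQG : divides p%:P (Q * G).
  by exists (k' *: F); rewrite -e ek [RHS]mulrC mul_polyC scalerA [p * _]mulrC.
have pI : injective ( *:%R p : {poly A} -> {poly A}).
  move=> U V /eqP; rewrite -!mul_polyC.
  by rewrite (inj_eq (mulfI _)) ?polyC_eq0 // => /eqP.
case: (prime_dvd_const_mul pp pQG) => -[H]; rewrite [H * _]mulrC mul_polyC => eH.
  apply: (IHn k' k'n H G k'0); apply: pI.
  by rewrite scalerA [p * _]mulrC -ek e eH scalerAl.
have [|c [G' [c0 eG'] dG']] := IHn k' k'n Q H k'0.
  by apply: pI; rewrite scalerA mulrC -ek e eH scalerAr.
exists (p * c), G' => //; split; first by rewrite mulf_neq0.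
by rewrite eH eG' scalerA.
Qed.

(** The division with remainder of [gcdp] finds a gcd up to a constant, and
    [cancel_const] makes it an honest common divisor. *)
Lemma common_divisor_or_bezout (A : idomainType) (F G : {poly A}) :
  factorial_domain A -> F != 0 ->
  (exists2 H : {poly A}, (1 < size H)%N & divides H F /\ divides H G) \/
  (exists U V c, c != 0 /\ U * F + V * G = c%:P).
Proof.
move=> fA F0; pose D := gcdp F G.
have D0 : D != 0 by rewrite gcdp_eq0 negb_and F0.
have [sD|sD] := leqP (size D) 1.
  right; have [u /eqpP [[c1 c2] /= /andP[c10 c20] e]] := Bezoutp F G.
  have [d ed] : exists d, D = d%:P.
    by exists D`_0; apply: size1_polyC.
  exists (c1 *: u.1), (c1 *: u.2), (c2 * d); split.
    by rewrite mulf_neq0 // -polyC_eq0 -ed.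
  by rewrite -!scalerAl -scalerDr e -/D ed polyCM mul_polyC.
left; have /Pdiv.WeakIdomain.dvdpP [[k Q] /= k0 e] := dvdp_gcdl F G.
have [c [D' [c0 eD] D'F]] := cancel_const fA k0 e.
have /Pdiv.WeakIdomain.dvdpP [[k' Q'] /= k'0 e'] := dvdp_gcdr F G.
have [|c' [D'' [c'0 eD'] D''G]] := @cancel_const A k' G (c *: Q') D' fA k'0.
  by rewrite -scalerAl scalerAr -eD.
exists D''; last first.
  split=> //; apply: divides_trans D'F.
  by exists c'%:P; rewrite mul_polyC.
by move: sD; rewrite -/D /D eD size_scale // eD' size_scale.
Qed.

(** An irreducible constant is prime by Gauss's lemma. If F is irreducible and
    not constant, and F divides G H, then either F and G have a common divisor
    of positive degree, which is F up to a unit, or a constant c is a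
    combination of F and G; then F divides c H, hence H. *)
Lemma factorial_poly (A : idomainType) :
  factorial_domain A -> factorial_domain {poly A}.
Proof.
move=> fA; have [[nu [nuM nuU]] pdiv] := fA.
pose mu (F : {poly A}) := (nu (lead_coef F) + (size F).-1)%N.
have muM F G : F != 0 -> G != 0 -> mu (F * G) = (mu F + mu G)%N.
  move=> F0 G0; rewrite /mu lead_coefM nuM ?lead_coef_eq0 // size_mul //.
  rewrite addnACA; congr (_ + _)%N.
  rewrite -(prednK (n := size F)) ?size_poly_gt0 //.
  by rewrite -{1}(prednK (n := size G)) ?size_poly_gt0 // addSn addnS.
have muU F : F != 0 -> mu F = 0%N -> F \is a GRing.unit.
  move=> F0 /eqP; rewrite addn_eq0 => /andP[/eqP h1 /eqP h2].
  have sF : size F = 1%N.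
    by rewrite -(prednK (n := size F)) ?size_poly_gt0 // h2.
  rewrite poly_unitE sF eqxx /=; move: h1; rewrite lead_coefE sF => /nuU; apply.
  by move: F0; rewrite -lead_coef_eq0 lead_coefE sF.
split; first by exists mu.
move=> F; elim: {F}(mu F).+1 {-2}F (ltnSn (mu F)) => // n IHn F Fn F0 FU.
(* By induction on mu, only an irreducible F has to be considered. *)
have [[G [H [eF GU HU]]]|irr] := pselect (exists G H, [/\ F = G * H,
    G \isn't a GRing.unit & H \isn't a GRing.unit]).
  have G0 : G != 0 by apply: contraNneq F0 => h; rewrite eF h mul0r.
  have H0 : H != 0 by apply: contraNneq F0 => h; rewrite eF h mulr0.
  have [||//|p pp pG] := IHn G.
  - move: Fn; rewrite ltnS eF muM // => /(leq_trans _); apply.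
    rewrite -[X in (X < _)%N]addn0 ltn_add2l lt0n.
    by apply: contra HU => /eqP /muU ->.
  - by [].
  by exists p => //; apply: divides_trans pG _; exists H; rewrite mulrC.
have irrF G : divides G F -> G \isn't a GRing.unit -> divides F G.
  case=> H eF GU; have HU : H \is a GRing.unit.
    by apply/negPn/negP => HU; apply: irr; exists G, H; rewrite mulrC.
  by exists H^-1; rewrite eF mulKr.
have sizeU (G : {poly A}) : (1 < size G)%N -> G \isn't a GRing.unit.
  by move=> sG; rewrite poly_unitE gtn_eqF.
have [sF|sF] := leqP (size F) 1.
  have eF := size1_polyC sF; have c0 : F`_0 != 0 by rewrite -polyC_eq0 -eF.
  have [|p pp [d ed]] := pdiv F`_0 c0.
    apply: contra FU => cU; rewrite poly_unitE cU andbT eF size_polyC.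
    by rewrite c0.
  exists p%:P; first exact: prime_polyC.
  by exists d%:P; rewrite -polyCM -ed.
have cancelF (k : A) (G : {poly A}) : k != 0 -> divides F (k *: G) -> divides F G.
  move=> k0 [Q e]; have [c [F' [c0 eF] F'G]] := cancel_const fA k0 e.
  apply: divides_trans F'G; apply: irrF.
    by exists c%:P; rewrite mul_polyC.
  by apply: sizeU; move: sF; rewrite eF size_scale.
exists F; last by exists 1; rewrite mul1r.
split=> // G H FGH.
have [[D sD [DF DG]]|[U [V [c [c0 e]]]]] := common_divisor_or_bezout G fA F0.
  by left; apply: divides_trans (irrF _ DF (sizeU _ sD)) DG.
right; apply: (cancelF c) => //; rewrite -mul_polyC -e mulrDl mulrAC.
case: FGH => K eK; exists (U * H + V * K).
by rewrite mulrDl -!mulrA -eK.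
Qed.

Lemma factorial_field (F : fieldType) : factorial_domain F.
Proof.
split; last by move=> a a0; rewrite unitfE a0.
by exists (fun=> 0%N); split=> // a a0 _; rewrite unitfE.
Qed.

Lemma factorial_transfer (A B : idomainType) (f : {rmorphism A -> B})
    (g : {rmorphism B -> A}) :
  cancel f g -> cancel g f -> factorial_domain A -> factorial_domain B.
Proof.
move=> fK gK [[nu [nuM nuU]] pdiv].
have f0 a : (f a == 0) = (a == 0) by rewrite -(rmorph0 f) (inj_eq (can_inj fK)).
have g0 a : (g a == 0) = (a == 0) by rewrite -(rmorph0 g) (inj_eq (can_inj gK)).
have fU a : (f a \is a GRing.unit) = (a \is a GRing.unit).
  apply/idP/idP => [h|]; last exact: rmorph_unit.
  by rewrite -(fK a) rmorph_unit.
have gU a : (g a \is a GRing.unit) = (a \is a GRing.unit) by rewrite -fU gK.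
split.
  exists (nu \o g); split=> [a b a0 b0|a a0 /= h] /=.
    by rewrite rmorphM nuM ?g0.
  by rewrite -gU nuU ?g0.
move=> b b0 bU; have [||p [p0 pU pP] [c e]] := pdiv (g b); rewrite ?g0 ?gU //.
exists (f p); last by exists (f c); rewrite -rmorphM -e gK.
split; rewrite ?f0 ?fU // => a b' [d ed].
have [|[x ex]|[x ex]] := pP (g a) (g b').
- by exists (g d); rewrite -rmorphM ed rmorphM fK.
- by left; exists (f x); rewrite -rmorphM -ex gK.
- by right; exists (f x); rewrite -rmorphM -ex gK.
Qed.

Lemma mpoly_rmorph_ext (n : nat) (R : comNzRingType) (S : comNzRingType)
    (f h : {rmorphism mpoly n R -> S}) :
  (forall c, f c%:MP = h c%:MP) -> (forall i, f 'X_i = h 'X_i) -> f =1 h.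
Proof.
move=> eC eX p; rewrite (mpolyE p) !rmorph_sum /=; apply: eq_bigr => m _.
rewrite -mul_mpolyC !rmorphM /= eC mpolyXE_id !rmorph_prod /=.
by congr (_ * _); apply: eq_bigr => i _; rewrite !rmorphXn /= eX.
Qed.

Lemma muniX (n : nat) (R : comNzRingType) (i : 'I_n) :
  muni ('X_(widen_ord (leqnSn n) i) : mpoly n.+1 R) = ('X_i)%:P.
Proof.
rewrite muniE msuppX big_seq1 mcoeffX eqxx scale1r /=.
rewrite !mnmE; have -> : (widen_ord (leqnSn n) i == ord_max) = false.
  by apply/eqP => /(congr1 val) /= h; have := ltn_ord i; rewrite h ltnn.
rewrite expr0 alg_polyC; congr ('X_[_])%:P.
apply/mnmP => j; rewrite !mnmE; congr (nat_of_bool _).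
Qed.

Lemma muniX_max (n : nat) (R : comNzRingType) :
  muni ('X_ord_max : mpoly n.+1 R) = 'X.
Proof.
rewrite muniE msuppX big_seq1 mcoeffX eqxx scale1r /=.
rewrite !mnmE eqxx expr1; set m := [multinom _ | _ < _].
have -> : m = 0%MM.
  apply/mnmP => j; rewrite !mnmE eqE /= gtn_eqF //.
by rewrite mpolyX0 scale1r.
Qed.

Lemma muni_iso (R : comNzRingType) (n : nat) :
  exists (f : {rmorphism {poly mpoly n R} -> mpoly n.+1 R})
         (g : {rmorphism mpoly n.+1 R -> {poly mpoly n R}}),
    [/\ cancel f g, cancel g f & g =1 @muni n R].
Proof.
have [f [fX fC]] : exists f : {rmorphism {poly mpoly n R} -> mpoly n.+1 R},
    f 'X = 'X_ord_max /\ forall c, f c%:P = mwiden c.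
  exists (horner_eval 'X_ord_max \o map_poly (@mwiden n R)); split=> [|c] /=.
    by rewrite map_polyX /horner_eval hornerX.
  by rewrite map_polyC /horner_eval hornerC.
have [g [gC gX gX_max gE]] :
    exists g : {rmorphism mpoly n.+1 R -> {poly mpoly n R}},
    [/\ forall c, g c%:MP = c%:MP%:P,
        forall i, g 'X_(widen_ord (leqnSn n) i) = ('X_i)%:P,
        g 'X_ord_max = 'X & g =1 @muni n R].
  exists (@muni n R); split=> [c|i||//] /=.
  - exact: muniC.
  - exact: muniX.
  - exact: muniX_max.
have gw c : g (mwiden c) = c%:P.
  apply: (@mpoly_rmorph_ext n R _ (g \o @mwiden n R) polyC) => [a|i].
    by rewrite /= mwidenC gC.
  by rewrite /= mwidenX mnmwiden1 gX.
exists f, g; split=> //.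
  elim/poly_ind => [|P c IHP]; first by rewrite !rmorph0.
  by rewrite !rmorphD !rmorphM IHP fX fC gw gX_max.
apply: (@mpoly_rmorph_ext n.+1 R _ (f \o g) idfun) => [c|i] /=.
  by rewrite gC fC mwidenC.
have [j ->|->] := unliftP ord_max i; last by rewrite gX_max fX.
have -> : lift ord_max j = widen_ord (leqnSn n) j.
  by apply: val_inj; rewrite /= /bump leqNgt ltn_ord.
by rewrite gX fC mwidenX mnmwiden1.
Qed.

Lemma factorial_mpoly (F : fieldType) (n : nat) : factorial_domain (mpoly n F).
Proof.
elim: n => [|n IHn].
  pose f : {rmorphism F -> mpoly 0 F} := @mpolyC 0 F.
  pose g : {rmorphism mpoly 0 F -> F} := meval (fun=> 0).
  apply: (factorial_transfer (f := f) (g := g)).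
  - by move=> c; rewrite /= mevalC.
  - apply: (@mpoly_rmorph_ext 0 F _ (f \o g) idfun) => [c|[]//].
    by rewrite /= mevalC.
  - exact: factorial_field.
have [f [g [fK gK _]]] := muni_iso F n.
exact: factorial_transfer fK gK (factorial_poly IHn).
Qed.

(** * Polynomials that vanish on an open set, and elimination along a direction *)

Lemma poly_eq0_injseq (R : idomainType) (p : {poly R}) (u : nat -> R) :
  injective u -> (forall k, p.[u k] = 0) -> p = 0.
Proof.
move=> uI up; apply: (@roots_geq_poly_eq0 _ _ (mkseq u (size p))).
- by apply/allP => x /mapP[k _ ->]; apply/rootP.
- by rewrite mkseq_uniq.
- by rewrite size_mkseq.
Qed.

Lemma poly_eq0_near (R : realFieldType) (p : {poly R}) (a r : R) :
  0 < r -> (forall x, `|x - a| < r -> p.[x] = 0) -> p = 0.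
Proof.
move=> r0 h; apply: (@poly_eq0_injseq _ p (fun k => a + r / k.+2%:R)) => [i j|k].
  move/addrI/(mulfI (lt0r_neq0 r0))/invr_inj/eqP; rewrite eqr_nat.
  by move/eqP => [].
apply: h; rewrite addrAC subrr add0r ger0_norm ?divr_ge0 ?ltW //.
by rewrite ltr_pdivrMr ?ltr0n // ltr_pMr // ltr1n.
Qed.

Lemma muni_meval (n : nat) (R : comNzRingType) (p : mpoly n.+1 R)
    (v : 'I_n.+1 -> R) :
  p.@[v] = (map_poly (meval (fun i => v (widen_ord (leqnSn n) i)))
              (muni p)).[v ord_max].
Proof.
pose e : {rmorphism mpoly n R -> R} :=
  meval (fun i => v (widen_ord (leqnSn n) i)).
apply: (@mpoly_rmorph_ext n.+1 R _ (meval v)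
  ((horner_eval (v ord_max) \o map_poly e) \o @muni n R)) => [c|i] /=.
  by rewrite muniC map_polyC /horner_eval hornerC /= !mevalC.
rewrite mevalXU; have [j ->|->] := unliftP ord_max i; last first.
  by rewrite muniX_max map_polyX /horner_eval hornerX.
have -> : lift ord_max j = widen_ord (leqnSn n) j.
  by apply: val_inj; rewrite /= /bump leqNgt ltn_ord.
by rewrite muniX map_polyC /horner_eval hornerC /= mevalXU.
Qed.

(** By induction on the number of variables, a polynomial in the last variable
    with infinitely many roots being zero. *)
Lemma mpoly_eq0_near (R : realFieldType) (n : nat) (p : mpoly n R)
    (a : 'I_n -> R) (r : R) :
  0 < r -> (forall v, (forall i, `|v i - a i| < r) -> p.@[v] = 0) -> p = 0.
Proof.
move=> r0; elim: n p a => [|n IHn] p a h.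
  have e : p = (p.@[a])%:MP.
    pose f : {rmorphism mpoly 0 R -> mpoly 0 R} := @mpolyC 0 R \o meval a.
    by apply: (@mpoly_rmorph_ext 0 R _ idfun f) => [c|[]//] /=; rewrite mevalC.
  by rewrite e h ?mpolyC0 // => -[].
have [f [g [_ gK gE]]] := muni_iso R n.
suff g0 : g p = 0 by rewrite -(gK p) g0 rmorph0.
rewrite gE; apply/polyP => k; rewrite coef0.
apply: (IHn _ (fun i => a (widen_ord (leqnSn n) i))) => w hw.
pose ext t (i : 'I_n.+1) := if insub (i : nat) is Some j then w j else t.
have extw t i : ext t (widen_ord (leqnSn n) i) = w i.
  by rewrite /ext insubT //= => hi; congr w; apply: val_inj.
have extm t : ext t ord_max = t by rewrite /ext insubF //= ltnn.
suff e0 : map_poly (meval w) (muni p) = 0.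
  by have /polyP /(_ k) := e0; rewrite coef_map coef0.
apply: (poly_eq0_near (a := a ord_max) r0) => t ht.
have := h (ext t); rewrite muni_meval extm => <-.
  congr (_.[t]); apply/polyP => i; rewrite !coef_map /=.
  by apply: meval_eq => j; rewrite extw.
move=> i; have [j ->|->] := unliftP ord_max i; last by rewrite extm.
have -> : lift ord_max j = widen_ord (leqnSn n) j.
  by apply: val_inj; rewrite /= /bump leqNgt ltn_ord.
by rewrite extw.
Qed.

Lemma mpoly_eq0_fun (R : realFieldType) (n : nat) (p : mpoly n R) :
  (forall v, p.@[v] = 0) -> p = 0.
Proof.
by move=> h; apply: (mpoly_eq0_near (a := fun=> 0) ltr01) => v _; apply: h.
Qed.

(** The value at (x, t) of a polynomial in n + 1 variables, one of which is
    singled out. *)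
Definition bieval (R : comNzRingType) (n : nat) (x : 'I_n -> R) (t : R)
    (P : {poly mpoly n R}) : R :=
  (map_poly (meval x) P).[t].

Lemma bievalD (R : comNzRingType) (n : nat) (x : 'I_n -> R) (t : R) :
  {morph bieval x t : P Q / P + Q}.
Proof. by move=> P Q; rewrite /bieval (rmorphD (map_poly (meval x))) hornerD. Qed.

Lemma bievalB (R : comNzRingType) (n : nat) (x : 'I_n -> R) (t : R) :
  {morph bieval x t : P Q / P - Q}.
Proof.
move=> P Q; rewrite /bieval (rmorphB (map_poly (meval x))) hornerD.
by rewrite hornerN.
Qed.

Lemma bievalM (R : comNzRingType) (n : nat) (x : 'I_n -> R) (t : R) :
  {morph bieval x t : P Q / P * Q}.
Proof. by move=> P Q; rewrite /bieval (rmorphM (map_poly (meval x))) hornerM. Qed.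

Lemma bievalC (R : comNzRingType) (n : nat) (x : 'I_n -> R) (t : R)
    (c : mpoly n R) : bieval x t c%:P = c.@[x].
Proof. by rewrite /bieval map_polyC hornerC. Qed.

Lemma bievalX (R : comNzRingType) (n : nat) (x : 'I_n -> R) (t : R) :
  bieval x t 'X = t.
Proof. by rewrite /bieval map_polyX hornerX. Qed.

Lemma bieval_ext (R : comNzRingType) (n : nat) (x y : 'I_n -> R) (t : R)
    (P : {poly mpoly n R}) : x =1 y -> bieval x t P = bieval y t P.
Proof.
move=> e; congr (_.[t]); apply/polyP => i; rewrite !coef_map /=.
exact: meval_eq.
Qed.

Lemma bieval0 (R : comNzRingType) (n : nat) (x : 'I_n -> R)
    (P : {poly mpoly n R}) : bieval x 0 P = (P`_0).@[x].
Proof. by rewrite /bieval horner_coef0 coef_map. Qed.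

Lemma poly_mpoly_eq0_fun (R : realFieldType) (n : nat) (P : {poly mpoly n R}) :
  (forall x t, bieval x t P = 0) -> P = 0.
Proof.
move=> h; apply/polyP => i; rewrite coef0; apply: mpoly_eq0_fun => x.
have e0 : map_poly (meval x) P = 0.
  by apply: (poly_eq0_near (a := 0) ltr01) => t _; apply: h.
by have /polyP /(_ i) := e0; rewrite coef_map coef0.
Qed.

(** The substitution x := x + T v, where T is the variable of the outer
    polynomial. *)
Definition shift_poly (R : comNzRingType) (n : nat) (v : 'I_n -> R) :
    mpoly n R -> {poly mpoly n R} :=
  mmap (polyC \o @mpolyC n R) (fun i => ('X_i)%:P + (v i)%:MP *: 'X).

HB.instance Definition _ (R : comNzRingType) (n : nat) (v : 'I_n -> R) :=
  GRing.RMorphism.copy (shift_poly v)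
    (mmap (polyC \o @mpolyC n R) (fun i => ('X_i)%:P + (v i)%:MP *: 'X)).

Lemma shift_polyE (R : comNzRingType) (n : nat) (v x : 'I_n -> R) (t : R)
    (p : mpoly n R) :
  bieval x t (shift_poly v p) = p.@[fun i => x i + t * v i].
Proof.
pose f := meval (fun i => x i + t * v i) : {rmorphism mpoly n R -> R}.
apply: (@mpoly_rmorph_ext n R _
  ((horner_eval t \o map_poly (meval x)) \o shift_poly v) f) => [c|i] /=.
  rewrite /shift_poly mmapC /= map_polyC /horner_eval hornerC /=.
  by rewrite !mevalC.
rewrite /shift_poly mmapX mmap1U /f /= mevalXU rmorphD /= map_polyC.
rewrite -mul_polyC rmorphM /= map_polyC map_polyX /horner_eval !hornerE /=.
by rewrite mevalXU mevalC mulrC.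
Qed.

Lemma shift_poly_coef0 (R : realFieldType) (n : nat) (v : 'I_n -> R)
    (p : mpoly n R) : (shift_poly v p)`_0 = p.
Proof.
apply/eqP; rewrite -subr_eq0; apply/eqP; apply: mpoly_eq0_fun => x.
rewrite mevalB; apply/eqP; rewrite subr_eq0; apply/eqP.
rewrite -bieval0 shift_polyE.
by apply: meval_eq => i; rewrite mul0r addr0.
Qed.

(** If a and b are coprime, then so are a(x + T v) and b(x + T v) as polynomials
    in T over the fraction field of the polynomials in x, so that some nonzero
    c free of T is a combination of them. *)
Lemma coprime_elimination (R : realFieldType) (n : nat) (v : 'I_n -> R)
    (a b : mpoly n R) :
  a != 0 -> (forall k, divides k a -> divides k b -> (msize k <= 1)%N) ->
  exists2 c : mpoly n R, c != 0 &
    forall x t, a.@[fun i => x i + t * v i] = 0 ->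
                b.@[fun i => x i + t * v i] = 0 -> c.@[x] = 0.
Proof.
have [S [S0 SE]] : exists S : mpoly n R -> {poly mpoly n R},
    (forall p, (S p)`_0 = p) /\
    forall p x t, bieval x t (S p) = p.@[fun i => x i + t * v i].
  exists (shift_poly v); split=> p *; first exact: shift_poly_coef0.
  exact: shift_polyE.
move=> a0 cop.
have F0 : S a != 0 by apply: contraNneq a0 => h; rewrite -(S0 a) h coef0.
have [|[U [V [c [c0 e]]]]] :=
    common_divisor_or_bezout (S b) (factorial_mpoly R n) F0; last first.
  exists c => // x t ax bx.
  have := congr1 (bieval x t) e.
  by rewrite bievalD !bievalM bievalC !SE ax bx !mulr0 addr0.
move=> [H sH [[Q eF] [Q' eG]]].
have coef0M (P P' : {poly mpoly n R}) : (P * P')`_0 = P`_0 * P'`_0.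
  by rewrite coefM big_ord1.
have ka : divides H`_0 a.
  by exists Q`_0; rewrite -coef0M -eF S0.
have kb : divides H`_0 b.
  by exists Q'`_0; rewrite -coef0M -eG S0.
have eH0 := msize1_polyC (cop _ ka kb); set k := (H`_0)@_0 in eH0.
suff : (H - (k%:MP)%:P) * S a = 0.
  move/eqP; rewrite mulf_eq0 (negPf F0) orbF subr_eq0 => /eqP eH.
  by move: sH; rewrite eH size_polyC; case: (_ != 0).
(* Let y = x + t v. Along the line s |-> (y - s v, s), the shifted a is
   constant, equal to a(y). If it is not 0, then its divisor H is constant on
   this line, hence equal to its value k at s = 0. *)
apply: poly_mpoly_eq0_fun => x t; rewrite bievalM bievalB bievalC.
rewrite mevalC SE.
set y := fun i => x i + t * v i.
have [->|ay] := eqVneq a.@[y] 0; first by rewrite mulr0.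
apply/eqP; rewrite mulf_eq0 (negPf ay) orbF subr_eq0; apply/eqP.
have [bk bkE] : exists bk : {rmorphism mpoly n R -> {poly R}},
    forall p s, (bk p).[s] = p.@[fun i => y i - s * v i].
  exists (map_poly (meval y) \o shift_poly (fun i => - v i)) => p s.
  rewrite -[LHS]/(bieval y s (shift_poly _ p)) shift_polyE.
  by apply: meval_eq => i; rewrite mulrN.
pose back P : {poly R} := (map_poly bk P).['X].
have backM P P' : back (P * P') = back P * back P'.
  by rewrite /back (rmorphM (map_poly bk)) hornerM.
have backD P P' : back (P + P') = back P + back P'.
  by rewrite /back (rmorphD (map_poly bk)) hornerD.
have backX : back 'X = 'X by rewrite /back (map_polyX bk) hornerX.
have backC c : back c%:P = bk c by rewrite /back (map_polyC bk) hornerC.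
have backE P s : (back P).[s] = bieval (fun i => y i - s * v i) s P.
  elim/poly_ind: P => [|P c IHP].
    by rewrite /back /bieval !map_poly0 !horner0.
  rewrite bievalD bievalM bievalX bievalC -IHP backD backM backX backC.
  by rewrite hornerD hornerM hornerX bkE.
have eback : back Q * back H = a.@[y]%:P.
  rewrite -backM -eF; apply/eqP; rewrite -subr_eq0; apply/eqP.
  apply: (poly_eq0_near (a := 0) ltr01) => s _.
  rewrite hornerD hornerN hornerC backE SE; apply/eqP.
  by rewrite subr_eq0; apply/eqP/meval_eq => i; rewrite subrK.
have sback : (size (back H) <= 1)%N.
  have : size (back Q * back H) = 1%N by rewrite eback size_polyC ay.
  have [->|bQ] := eqVneq (back Q) 0; first by rewrite mul0r size_poly0.
  have [->|bH] := eqVneq (back H) 0; first by rewrite mulr0 size_poly0.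
  rewrite size_mul // -(prednK (n := size (back Q))) ?size_poly_gt0 //.
  by rewrite addSn /= => <-; rewrite leq_addl.
have := backE H t; rewrite (size1_polyC sback) hornerC.
rewrite -horner_coef0 backE bieval0 eH0 mevalC => ->.
by apply: bieval_ext => j; rewrite /y addrK.
Qed.

(** * Positive definite matrices *)

Definition qform (R : pzRingType) (N : nat) (A : 'M[R]_N) (v : 'cV[R]_N) : R :=
  (v^T *m A *m v) ord0 ord0.

Definition entry_sum (R : numDomainType) (N : nat) (A : 'M[R]_N) : R :=
  \sum_i \sum_j `|A i j|.

Section QuadraticForms.
Variables (R : realType) (N : nat).
Implicit Types (A B : 'M[R]_N) (v w : 'cV[R]_N).

Lemma qform_sum A v : qform A v = \sum_i \sum_j v i ord0 * A i j * v j ord0.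
Proof.
rewrite /qform -mulmxA mxE; apply: eq_bigr => i _.
rewrite !mxE mulr_sumr; apply: eq_bigr => j _; by rewrite mulrA.
Qed.

Lemma qformD A B v : qform (A + B) v = qform A v + qform B v.
Proof. by rewrite /qform mulmxDr mulmxDl mxE. Qed.

Lemma qformZ a A v : qform (a *: A) v = a * qform A v.
Proof. by rewrite /qform -scalemxAr -scalemxAl mxE. Qed.

Lemma qform1 v : qform 1%:M v = \sum_i v i ord0 ^+ 2.
Proof. by rewrite /qform mulmx1 mxE; apply: eq_bigr => i _; rewrite mxE. Qed.

Lemma qform1_ge0 v : 0 <= qform 1%:M v.
Proof. by rewrite qform1 sumr_ge0 // => i _; rewrite sqr_ge0. Qed.

Lemma qform1_eq0 v : qform 1%:M v = 0 -> v = 0.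
Proof.
rewrite qform1 => /eqP; rewrite psumr_eq0 => [/allP h|i _]; last exact: sqr_ge0.
apply/colP => i; rewrite mxE; apply/eqP; rewrite -sqrf_eq0.
by apply: h; rewrite mem_index_enum.
Qed.

Lemma qform1_gt0 v : v != 0 -> 0 < qform 1%:M v.
Proof.
move=> v0; rewrite lt0r qform1_ge0 andbT; apply: contra v0 => /eqP h.
by apply/eqP/qform1_eq0.
Qed.

Lemma qform_addr A v w t : A^T = A ->
  qform A (v + t *: w)
    = qform A v + 2 * t * (w^T *m A *m v) ord0 ord0 + t ^+ 2 * qform A w.
Proof.
move=> sA; have e : (v^T *m A *m w) = (w^T *m A *m v).
  rewrite -[LHS]trmxK; have -> : ((v^T *m A *m w)^T) = w^T *m A *m v.
    by rewrite !trmx_mul trmxK sA mulmxA.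
  by apply/matrixP => i j; rewrite !ord1 mxE.
rewrite /qform; have -> : (v + t *: w)^T = v^T + t *: w^T.
  by apply/matrixP => i j; rewrite !mxE.
rewrite !mulmxDl !mulmxDr -!scalemxAl -!scalemxAr e.
rewrite scalerA !mxE; ring.
Qed.

(** The minimum over t is a - b^2 / c, attained at t = - b / c; if c = 0, the
    function of t is affine, and bounded below only for b = 0. *)
Lemma quadratic_ge0 (a b c : R) :
  0 <= c -> (forall t, 0 <= a + 2 * t * b + t ^+ 2 * c) -> b ^+ 2 <= a * c.
Proof.
rewrite le_eqVlt => /predU1P[<-|c0] h.
  rewrite mulr0; have [->|b0] := eqVneq b 0; first by rewrite expr0n.
  have := h (- (a + 1) / (2 * b)); rewrite mulr0 addr0.
  have -> : 2 * (- (a + 1) / (2 * b)) * b = - (a + 1) by field.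
  by rewrite opprD addrA subrr sub0r oppr_ge0 ler10.
have := h (- b / c).
have -> : a + 2 * (- b / c) * b + (- b / c) ^+ 2 * c = (a * c - b ^+ 2) / c.
  by field; rewrite lt0r_neq0.
by rewrite pmulr_lge0 ?invr_gt0 // subr_ge0.
Qed.

Lemma psdmx_cauchy_schwarz A v w : psdmx A ->
  ((w^T *m A *m v) ord0 ord0) ^+ 2 <= qform A v * qform A w.
Proof.
move=> [sA pA]; apply: quadratic_ge0; first exact: pA.
by move=> t; rewrite -qform_addr //; apply: pA.
Qed.

Lemma pdmxW A : pdmx A -> psdmx A.
Proof.
move=> [sA pA]; split=> // v; have [->|v0] := eqVneq v 0.
  by rewrite mulmx0 mxE.
by rewrite ltW // pA.
Qed.

Lemma psdmx_kernel A v : psdmx A -> qform A v = 0 -> A *m v = 0.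
Proof.
move=> pA q0; apply: qform1_eq0.
have := psdmx_cauchy_schwarz v (A *m v) pA; rewrite q0 mul0r.
have [sA _] := pA.
rewrite le_eqVlt ltNge sqr_ge0 orbF sqrf_eq0 => /eqP <-.
by rewrite /qform mulmx1 -mulmxA.
Qed.

Lemma psdmx_unit_pdmx A : psdmx A -> \det A != 0 -> pdmx A.
Proof.
move=> pA dA; have [sA qA] := pA; split=> // v v0.
rewrite lt0r qA andbT; apply: contra v0 => /eqP /(psdmx_kernel pA) h.
have uA : A \in unitmx by rewrite unitmxE unitfE.
by rewrite -(mulKmx uA v) h mulmx0.
Qed.

Lemma pdmx_det_neq0 A : pdmx A -> \det A != 0.
Proof.
move=> [sA pA]; apply/negP => /det0P [v v0 h].
have := pA v^T; rewrite trmxK h mul0mx mxE ltxx => /(_ _)/notF; apply.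
by apply: contra v0 => /eqP h'; rewrite -(trmxK v) h' trmx0.
Qed.

Lemma pdmx_segment A t : pdmx A -> 0 <= t <= 1 ->
  pdmx ((1 - t)%:M + t *: A).
Proof.
move=> [sA pA] /andP[t0 t1]; split.
  by rewrite linearD /= tr_scalar_mx linearZ /= sA.
move=> v v0; rewrite -[X in 0 < X]/(qform _ _) -scalemx1 qformD !qformZ.
have q1 := qform1_gt0 v0; have qA : 0 < qform A v := pA v v0.
have [->|tn1] := eqVneq t 1; first by rewrite subrr mul0r add0r mul1r.
have lt1 : 0 < 1 - t by rewrite subr_gt0 lt_neqAle tn1.
have := mulr_gt0 lt1 q1; have := mulr_ge0 t0 (ltW qA); lra.
Qed.

(** The segment from Id to A consists of positive definite matrices, so that the
    determinant does not vanish between its value 1 at Id and its value at A. *)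
Lemma pdmx_det_gt0 A : pdmx A -> 0 < \det A.
Proof.
move=> pA; rewrite lt_neqAle eq_sym pdmx_det_neq0 //= leNgt.
apply/negP => dA.
pose P := \det ((1 - 'X)%:M + 'X *: map_mx polyC A).
have PE t : P.[t] = \det ((1 - t)%:M + t *: A).
  rewrite -[LHS]/(horner_eval t P) -det_map_mx; congr (\det _).
  apply/matrixP => i j; rewrite !mxE -[LHS]/(horner _ t) hornerD hornerMn hornerM.
  by rewrite hornerD hornerN !hornerC hornerX.
have [||t tI /rootP] := @poly_ivt R (- P) 0 1.
- by rewrite ler01.
- rewrite !hornerN !PE subr0 scale0r addr0 det1 subrr scale1r.
  rewrite (_ : 0%:M = 0) ?add0r; last by apply/matrixP => i j; rewrite !mxE mul0rn.
  by rewrite oppr_le0 ler01 oppr_ge0 ltW.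
rewrite hornerN PE => /eqP; rewrite oppr_eq0; apply/negP/pdmx_det_neq0.
by apply: pdmx_segment => //; rewrite -in_itv.
Qed.

Lemma qform_le A v : `|qform A v| <= entry_sum A * qform 1%:M v.
Proof.
have hv (i : 'I_N) : v i ord0 ^+ 2 <= qform 1%:M v.
  rewrite qform1 (bigD1 i) //= lerDl sumr_ge0 // => j _; exact: sqr_ge0.
rewrite qform_sum /entry_sum mulr_suml.
apply: le_trans (ler_norm_sum _ _ _) _; apply: ler_sum => i _.
rewrite mulr_suml.
apply: le_trans (ler_norm_sum _ _ _) _; apply: ler_sum => j _.
rewrite mulrAC normrM mulrC ler_wpM2l //.
have := hv i; have := hv j; set x := v i _; set y := v j _; set q := qform _ _.
move=> hx hy; rewrite ler_norml.
have h1 := sqr_ge0 (x + y); have h2 := sqr_ge0 (x - y); nra.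
Qed.

(** Cauchy-Schwarz for A and the vectors v and A^-1 v gives
    |v|^4 <= (v^T A v) (v^T A^-1 v), and v^T A^-1 v <= K |v|^2. *)
Lemma pdmx_coercive A : pdmx A ->
  exists2 c, 0 < c & forall v, c * qform 1%:M v <= qform A v.
Proof.
move=> pA; have uA : A \in unitmx by rewrite unitmxE unitfE pdmx_det_neq0.
pose K := entry_sum (invmx A) + 1.
have K0 : 0 < K.
  by rewrite ltr_wpDl // sumr_ge0 // => i _; rewrite sumr_ge0.
exists K^-1; rewrite ?invr_gt0 // => v.
have [->|v0] := eqVneq v 0; first by rewrite /qform !mulmx0 mxE mulr0.
have [sA _] := pA.
have := psdmx_cauchy_schwarz v (invmx A *m v) (pdmxW pA).
have e1 : ((invmx A *m v)^T *m A *m v) ord0 ord0 = qform 1%:M v.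
  by rewrite trmx_mul trmx_inv sA mulmxKV // /qform mulmx1.
have e2 : qform A (invmx A *m v) = qform (invmx A) v.
  rewrite /qform trmx_mul trmx_inv sA mulmxKV // mulmxA //.
rewrite e1 e2 => h; have q1 := qform1_gt0 v0.
have hK : qform (invmx A) v <= K * qform 1%:M v.
  apply: le_trans (ler_norm _) _; apply: le_trans (qform_le _ _) _.
  by rewrite ler_pM2r // lerDl ler01.
have qA : 0 <= qform A v by have [_] := pdmxW pA; apply.
have : qform 1%:M v ^+ 2 <= qform A v * (K * qform 1%:M v).
  by apply: le_trans h _; apply: ler_wpM2l.
rewrite mulrA expr2 ler_pM2r // => h'.
by rewrite mulrC ler_pdivrMr.
Qed.

Lemma pdmx_open A : pdmx A ->
  exists2 e, 0 < e &
    forall B, B^T = B -> entry_sum (B - A) < e -> pdmx B.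
Proof.
move=> pA; have [c c0 hc] := pdmx_coercive pA; exists c => // B sB hB.
split=> // v v0; rewrite -[X in 0 < X]/(qform _ _) -[B](subrK A) qformD.
have := qform_le (B - A) v; rewrite ler_norml => /andP[h _].
have q1 := qform1_gt0 v0; have := hc v.
have : entry_sum (B - A) * qform 1%:M v < c * qform 1%:M v by rewrite ltr_pM2r.
lra.
Qed.

End QuadraticForms.

(** * Sets of positive definite values of a star-shaped family *)

Lemma mpoly_at_continuous (R : realType) (m : nat) (p : mpoly m R) :
  continuous (mpoly_at p : 'rV[R]_m -> R).
Proof.
have mul_c (f g : 'rV[R]_m -> R) : continuous f -> continuous g ->
    continuous (fun x => f x * g x).
  by move=> cf cg x; exact: (cvgM (cf x) (cg x)).
have exp_c (f : 'rV[R]_m -> R) k : continuous f -> continuous (fun x => f x ^+ k).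
  move=> cf; elim: k => [|k IHk].
    have -> : (fun x => f x ^+ 0) = fun=> 1 by apply/funext => x; rewrite expr0.
    exact: cst_continuous.
  have -> : (fun x => f x ^+ k.+1) = fun x => f x * f x ^+ k.
    by apply/funext => x; rewrite exprS.
  exact: mul_c.
have sum_c (I : Type) (F : I -> 'rV[R]_m -> R) r :
    (forall i, continuous (F i)) -> continuous (fun x => \sum_(i <- r) F i x).
  move=> cF; elim: r => [|i r IHr].
    have -> : (fun x => \sum_(i <- [::]) F i x) = fun=> 0.
      by apply/funext => x; rewrite big_nil.
    exact: cst_continuous.
  have -> : (fun x => \sum_(i <- i :: r) F i x)
          = fun x => F i x + \sum_(i <- r) F i x.
    by apply/funext => x; rewrite big_cons.
  by move=> x; exact: (cvgD (cF i x) (IHr x)).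
have prod_c (I : Type) (F : I -> 'rV[R]_m -> R) r :
    (forall i, continuous (F i)) -> continuous (fun x => \prod_(i <- r) F i x).
  move=> cF; elim: r => [|i r IHr].
    have -> : (fun x => \prod_(i <- [::]) F i x) = fun=> 1.
      by apply/funext => x; rewrite big_nil.
    exact: cst_continuous.
  have -> : (fun x => \prod_(i <- i :: r) F i x)
          = fun x => F i x * \prod_(i <- r) F i x.
    by apply/funext => x; rewrite big_cons.
  exact: mul_c.
apply: sum_c => u; apply: mul_c; first exact: cst_continuous.
by apply: prod_c => i; apply: exp_c; apply: coord_continuous.
Qed.

Lemma mpoly_atM (R : realType) (m : nat) (x : 'rV[R]_m) :
  {morph (fun p => mpoly_at p x) : p q / p * q}.
Proof. by move=> p q; rewrite /mpoly_at mevalM. Qed.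

Lemma line_poly (R : realType) (m : nat) (p : mpoly m R) (x v : 'rV[R]_m) :
  exists P : {poly R}, forall t, P.[t] = mpoly_at p (x + t *: v).
Proof.
exists (map_poly (meval (fun s => x ord0 s)) (shift_poly (fun s => v ord0 s) p)).
move=> t; rewrite -[LHS]/(bieval _ t _) shift_polyE.
by apply: meval_eq => s; rewrite !mxE.
Qed.

Definition segment_set (R : realType) (m : nat) (x y : 'rV[R]_m) :
    set 'rV[R]_m :=
  (fun t : R => x + t *: (y - x)) @` `[0, 1].

Lemma row_line_continuous (R : realType) (m : nat) (x v : 'rV[R]_m) :
  continuous (fun t : R => x + t *: v).
Proof.
move=> t; apply: cvgD; first exact: cvg_cst.
by apply: cvgZ; [exact: cvg_id|exact: cvg_cst].
Qed.

Lemma segment_set_connected (R : realType) (m : nat) (x y : 'rV[R]_m) :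
  connected (segment_set x y).
Proof.
apply: connected_continuous_connected; first exact: segment_connected.
exact/continuous_subspaceT/row_line_continuous.
Qed.

Lemma segment_set_l (R : realType) (m : nat) (x y : 'rV[R]_m) :
  segment_set x y x.
Proof. by exists 0; rewrite ?scale0r ?addr0 //= in_itv /= lexx ler01. Qed.

Lemma segment_set_r (R : realType) (m : nat) (x y : 'rV[R]_m) :
  segment_set x y y.
Proof. by exists 1; rewrite ?scale1r ?subrKC //= in_itv /= lexx ler01. Qed.

Lemma nbhs_row (R : realType) (m : nat) (x : 'rV[R]_m) (W : set 'rV[R]_m) :
  nbhs x W <-> exists2 r, 0 < r &
    forall y : 'rV[R]_m, (forall s, `|y ord0 s - x ord0 s| < r) -> W y.
Proof.
split.
  move/nbhs_ballP => [r r0 h]; exists r => // y hy; apply: h; split=> // i j.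
  by rewrite ord1 -ball_normE /= distrC.
move=> [r r0 h]; apply/nbhs_ballP; exists r => // y [_ hy]; apply: h => s.
by have := hy ord0 s; rewrite -ball_normE /= distrC.
Qed.

Lemma entry_le_norm1 (R : realType) (m : nat) (x : 'rV[R]_m) s :
  `|x ord0 s| <= \sum_s `|x ord0 s|.
Proof. by rewrite (bigD1 s) //= lerDl; apply: sumr_ge0 => i _; exact: normr_ge0. Qed.

Lemma norm_convex_lt (R : realType) (a b r t : R) :
  `|a| < r -> `|b| < r -> 0 <= t <= 1 -> `|(1 - t) * a + t * b| < r.
Proof.
move=> ha hb /andP[t0 t1]; apply: le_lt_trans (ler_normD _ _) _.
rewrite !normrM (ger0_norm t0) ger0_norm ?subr_ge0 //.
have [->|tn1] := eqVneq t 1; first by rewrite subrr mul0r add0r mul1r.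
have t1' : 0 < 1 - t by rewrite subr_gt0 lt_neqAle tn1.
have : 0 < (1 - t) * (r - `|a|) by rewrite mulr_gt0 // subr_gt0.
have : 0 <= t * (r - `|b|) by rewrite mulr_ge0 // subr_ge0 ltW.
lra.
Qed.

Section AffineMatrixFamily.
Variables (R : realType) (m N : nat) (A : 'M[mpoly m R]_N).

Definition mpolymx_at (x : 'rV[R]_m) : 'M[R]_N := \matrix_(i, j) mpoly_at (A i j) x.

Definition pd_set : set 'rV[R]_m := [set x | pdmx (mpolymx_at x)].
Definition psd_set : set 'rV[R]_m := [set x | psdmx (mpolymx_at x)].
(** Under the two hypotheses below, this is the topological boundary of
    [psd_set], by [psd_boundary_exterior] and [pd_set_open]. *)
Definition psd_boundary : set 'rV[R]_m :=
  [set x | psdmx (mpolymx_at x) /\ \det (mpolymx_at x) = 0].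

Hypothesis A_sym : forall x, (mpolymx_at x)^T = mpolymx_at x.
Hypothesis A_star : forall t x,
  mpolymx_at (t *: x) = (1 - t)%:M + t *: mpolymx_at x.

Local Notation E := mpolymx_at.

Lemma mpolymx_at0 : E 0 = 1%:M.
Proof.
by rewrite -(scale0r (0 : 'rV[R]_m)) A_star subr0 scale0r addr0.
Qed.

Lemma mpolymx_at_det x : \det (E x) = mpoly_at (\det A) x.
Proof.
rewrite /mpoly_at -[RHS]det_map_mx; congr (\det _).
by apply/matrixP => i j; rewrite !mxE.
Qed.

Lemma pd_set0 : pd_set 0.
Proof.
rewrite /pd_set /= mpolymx_at0; split; first by rewrite trmx1.
exact: qform1_gt0.
Qed.

Lemma pd_setE x : pd_set x <-> psd_set x /\ ~ psd_boundary x.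
Proof.
split=> [p|[p nb]].
  split; first exact: pdmxW.
  by case=> _ /eqP; apply/negP/pdmx_det_neq0.
apply: psdmx_unit_pdmx => //; apply/eqP => d0; exact: nb.
Qed.

Lemma qform_at_continuous (v : 'cV[R]_N) : continuous (fun x => qform (E x) v).
Proof.
pose p : mpoly m R := \sum_i \sum_j (v i ord0 * v j ord0) *: A i j.
suff e : (fun x => qform (E x) v) = mpoly_at p.
  by rewrite e; apply: mpoly_at_continuous.
apply/funext => x; rewrite qform_sum /mpoly_at rmorph_sum; apply: eq_bigr => i _.
rewrite rmorph_sum; apply: eq_bigr => j _.
by rewrite /= mevalZ !mxE mulrAC.
Qed.


Lemma pd_set_open : open pd_set.
Proof.
rewrite openE => x px; have [e e0 he] := pdmx_open px.
have near_ij (i j : 'I_N) : \forall y \near x,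
    `|mpoly_at (A i j) y - mpoly_at (A i j) x| < e / (N * N).+1%:R.
  have := @mpoly_at_continuous R m (A i j) x.
  move=> /cvgrPdist_lt /(_ (e / (N * N).+1%:R)).
  rewrite divr_gt0 ?ltr0n // => /(_ isT).
  by apply: filterS => y; rewrite distrC.
have near_all := filter_forall (f := fun (ij : 'I_N * 'I_N) y =>
    `|mpoly_at (A ij.1 ij.2) y - mpoly_at (A ij.1 ij.2) x| < e / (N * N).+1%:R)
    (nbhs_filter x) (fun ij => near_ij ij.1 ij.2).
apply: filterS near_all => y hy; apply: he; first exact: A_sym.
rewrite /entry_sum pair_big /=.
apply: le_lt_trans (_ : \sum_(ij : 'I_N * 'I_N) e / (N * N).+1%:R < _).
  by apply: ler_sum => -[i j] _; rewrite !mxE ltW // (hy (i, j)).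
rewrite sumr_const card_prod card_ord -[ltLHS]mulr_natr mulrAC -mulrA gtr_pMr //.
by rewrite ltr_pdivrMr ?ltr0n // mul1r ltr_nat.
Qed.

Lemma psd_set_closed : closed psd_set.
Proof.
have -> : psd_set = \bigcap_(v in [set: 'cV[R]_N])
    (fun x => qform (E x) v) @^-1` [set t | 0 <= t].
  apply/seteqP; split=> [x [_ h] v _|x h]; first exact: h.
  by split=> // v; apply: h.
apply: closed_bigI => v _; apply: preimage_closed; last exact: closed_ge.
by move=> x _; apply: qform_at_continuous.
Qed.

(** Positive definiteness is an open condition, and away from the boundary it
    is the closed condition of being positive semidefinite. *)
Lemma connected_sub_pd_set (C : set 'rV[R]_m) x :
  connected C -> C x -> pd_set x -> (forall y, C y -> ~ psd_boundary y) ->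
  C `<=` pd_set.
Proof.
move=> cC Cx px nb.
suff <- : C `&` pd_set = C by move=> y [].
apply: cC; first by exists x.
- by exists pd_set => //; exact: pd_set_open.
- exists psd_set; first exact: psd_set_closed.
  apply/seteqP; split=> y [Cy py]; split=> //; first by have [] := (pd_setE y).1 py.
  by apply/pd_setE; split=> //; apply: nb.
Qed.

Lemma pd_set_star x t : pd_set x -> 0 <= t <= 1 -> pd_set (t *: x).
Proof. by move=> px t01; rewrite /pd_set /= A_star; apply: pdmx_segment. Qed.

Lemma psd_set_star x t : psd_set x -> 0 <= t < 1 -> pd_set (t *: x).
Proof.
move=> [sx px] /andP[t0 t1]; split; first by rewrite A_sym.
move=> v v0; rewrite A_star -[X in 0 < X]/(qform _ _) -scalemx1 qformD !qformZ.
have q1 := qform1_gt0 v0; have qE : 0 <= qform (E x) v := px v.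
have t1' : 0 < 1 - t by rewrite subr_gt0.
by have := mulr_gt0 t1' q1; have := mulr_ge0 t0 qE; lra.
Qed.

(** A kernel vector v of E z satisfies v^T E((1 + s) z) v = - s |v|^2. *)
Lemma psd_boundary_exterior z s : psd_boundary z -> 0 < s ->
  exists v, qform (E ((1 + s) *: z)) v < 0.
Proof.
move=> [[_ _] /eqP /det0P [u u0 hu]] s0; exists u^T.
have q0 : qform (E z) u^T = 0 by rewrite /qform trmxK hu mul0mx mxE.
have u0' : u^T != 0.
  by apply: contra u0 => /eqP h; rewrite -(trmxK u) h trmx0.
rewrite A_star -scalemx1 qformD !qformZ q0 mulr0 addr0.
by have := mulr_gt0 s0 (qform1_gt0 u0'); lra.
Qed.

Lemma segment_set0_sub x : pd_set x -> segment_set 0 x `<=` pd_set.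
Proof.
move=> px _ [t t01 <-]; rewrite subr0 add0r; exact: pd_set_star.
Qed.

Lemma component_pd_set (h : 'rV[R]_m -> R) :
  (forall x, pd_set x -> 0 < h x) ->
  (forall x, psd_boundary x -> h x = 0) ->
  connected_component [set x | 0 < h x] 0 = pd_set.
Proof.
move=> hpos h0; apply/seteqP; split.
  apply: (@connected_sub_pd_set _ 0).
  - exact: component_connected.
  - by apply: connected_component_refl; apply/hpos/pd_set0.
  - exact: pd_set0.
  - by move=> y /connected_component_sub /= + /h0 => /[swap] ->; rewrite ltxx.
move=> x px; have sub := segment_set0_sub px.
apply: (connected_component_max (B := segment_set 0 x)).
- exact: segment_set_l.
- by move=> y /sub /hpos.
- exact: segment_set_connected.
- exact: segment_set_r.
Qed.

Lemma component_pd_set_self : connected_component pd_set 0 = pd_set.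
Proof.
apply/seteqP; split; first exact: connected_component_sub.
move=> x px; apply: (connected_component_max (B := segment_set 0 x)).
- exact: segment_set_l.
- exact: segment_set0_sub.
- exact: segment_set_connected.
- exact: segment_set_r.
Qed.

(** The points t x with t < 1 are positive definite and tend to x. *)
Lemma closure_pd_set : closure pd_set = psd_set.
Proof.
apply/seteqP; split.
  have /closure_id -> := psd_set_closed.
  by apply: closureS => x; exact: pdmxW.
move=> x px W /nbhs_row [r r0 hW].
pose K := \sum_s `|x ord0 s|; have K0 : 0 <= K by exact: sumr_ge0.
pose s := r / (r + 1 + K).
have d0 : 0 < r + 1 + K by lra.
have s0 : 0 < s by rewrite divr_gt0.
have s1 : s <= 1 by rewrite ler_pdivrMr // mul1r; lra.
exists ((1 - s) *: x); split.
  by apply: psd_set_star => //; apply/andP; split; lra.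
apply: hW => i; rewrite !mxE mulrBl mul1r addrAC subrr add0r normrN normrM.
rewrite gtr0_norm //; apply: le_lt_trans (_ : s * K < _).
  by apply: ler_wpM2l; [exact: ltW|exact: entry_le_norm1].
by rewrite /s mulrAC ltr_pdivrMr //; nra.
Qed.

Lemma defining_poly_of_pos (p : mpoly m R) :
  (forall x, pd_set x -> 0 < mpoly_at p x) ->
  (forall x, psd_boundary x -> mpoly_at p x = 0) ->
  defining_poly psd_set p.
Proof.
move=> ppos p0; split; first exact/ppos/pd_set0.
by rewrite /alg_interior_closure component_pd_set // closure_pd_set.
Qed.

Lemma det_defining_poly : defining_poly psd_set (\det A).
Proof.
apply: defining_poly_of_pos => x; rewrite -mpolymx_at_det.
  exact: pdmx_det_gt0.
by case.
Qed.

(** If p were positive at z, then the component that defines the set would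
    contain a neighbourhood of z, and with it points (1 + s) z. *)
Lemma defining_poly_boundary (p : mpoly m R) z :
  defining_poly psd_set p -> psd_boundary z -> mpoly_at p z = 0.
Proof.
move=> [p0 psdE] zb; set U := connected_component [set x | 0 < mpoly_at p x] 0.
have zU : closure U z.
  by rewrite -[closure U]/(alg_interior_closure p) -psdE; case: zb.
have cp := @mpoly_at_continuous R m p.
have pz : 0 <= mpoly_at p z.
  have cl : closed [set x | 0 <= mpoly_at p x].
    apply: (@preimage_closed _ _ (mpoly_at p) [set t | 0 <= t]).
      by move=> x _; apply: cp.
    exact: closed_ge.
  have : closure [set x | 0 <= mpoly_at p x] z.
    by apply: closureS zU => x /connected_component_sub /ltW.
  by have /closure_id <- := cl.
apply/eqP; rewrite eq_le pz andbT leNgt; apply/negP => {}pz.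
have /nbhs_row [r r0 hr] : nbhs z [set x | 0 < mpoly_at p x].
  have /(cp z) : nbhs (mpoly_at p z) [set t | 0 < t] by exact: lt_nbhsr.
  by [].
have /zU [u [Uu hu]] : nbhs z [set y : 'rV[R]_m |
    forall s, `|y ord0 s - z ord0 s| < r].
  by apply/nbhs_row; exists r.
pose K := \sum_s `|z ord0 s|; have K0 : 0 <= K by exact: sumr_ge0.
pose s := r / (1 + K).
have s0 : 0 < s by rewrite divr_gt0 //; lra.
pose w := (1 + s) *: z.
have hw i : `|w ord0 i - z ord0 i| < r.
  rewrite !mxE mulrDl mul1r addrAC subrr add0r normrM gtr0_norm //.
  apply: le_lt_trans (_ : s * K < _).
    by apply: ler_wpM2l; [exact: ltW|exact: entry_le_norm1].
  by rewrite /s mulrAC ltr_pdivrMr; nra.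
have Uw : U w.
  apply: connected_component_trans Uu _.
  apply: (connected_component_max (B := segment_set u w)).
  - exact: segment_set_l.
  - move=> _ [t + <-]; rewrite /= in_itv /= => /andP[t0 t1]; apply: hr => i.
    rewrite [X in `|X|](_ : _ =
      (1 - t) * (u ord0 i - z ord0 i) + t * (w ord0 i - z ord0 i)); last first.
      by rewrite !mxE; ring.
    by apply: norm_convex_lt => //; apply/andP.
  - exact: segment_set_connected.
  - exact: segment_set_r.
have [v] := psd_boundary_exterior zb s0; apply/negP; rewrite -leNgt.
have : psd_set w by rewrite psdE; apply: subset_closure.
by case=> _; apply.
Qed.
End AffineMatrixFamily.

(** * Polynomials that vanish on the boundary *)

Lemma msize_divides_le (R : idomainType) (m : nat) (p q : mpoly m R) :
  q != 0 -> divides p q -> (msize p <= msize q)%N.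
Proof.
move=> q0 [c e]; have c0 : c != 0 by apply: contraNneq q0 => h; rewrite e h mul0r.
have p0 : p != 0 by apply: contraNneq q0 => h; rewrite e h mulr0.
by rewrite e msizeM // (mpolySpred _ c0) addSn leq_addl.
Qed.

(** A common divisor of largest degree leaves coprime cofactors. *)
Lemma maximal_common_divisor (R : idomainType) (m : nat) (f g : mpoly m R) :
  f != 0 -> exists h a b, [/\ f = a * h, g = b * h &
    forall k, divides k a -> divides k b -> (msize k <= 1)%N].
Proof.
move=> f0.
pose P k := `[< exists h, [/\ divides h f, divides h g & msize h = k] >].
have Pex : exists k, P k.
  exists (msize (1 : mpoly m R)); apply/asboolP; exists 1; split=> //.
    by exists f; rewrite mulr1.
  by exists g; rewrite mulr1.
have Pbound k : P k -> (k <= msize f)%N.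
  by move=> /asboolP [h [hf _ <-]]; apply: msize_divides_le.
case: (ex_maxnP Pex Pbound) => k /asboolP [h [[a ef] [b eg] <-]] hmax.
exists h, a, b; split=> // d [a' ea] [b' eb].
have d0 : d != 0 by apply: contraNneq f0 => e; rewrite ef ea e mulr0 mul0r.
have h0 : h != 0 by apply: contraNneq f0 => e; rewrite ef e mulr0.
have e : msize (d * h) = (msize d + (msize h).-1)%N.
  by rewrite msizeM // [in LHS](mpolySpred _ h0) addnS.
have : (msize (d * h) <= msize h)%N.
  apply: hmax; apply/asboolP; exists (d * h); split=> //.
  - by exists a'; rewrite mulrA -ea.
  - by exists b'; rewrite mulrA -eb.
by rewrite e [X in (_ <= X)%N](mpolySpred _ h0) -add1n leq_add2r.
Qed.

Section BoundaryPolynomials.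
Variables (R : realType) (m N : nat) (A : 'M[mpoly m R]_N).
Hypothesis A_sym : forall x, (mpolymx_at A x)^T = mpolymx_at A x.
Hypothesis A_star : forall t x,
  mpolymx_at A (t *: x) = (1 - t)%:M + t *: mpolymx_at A x.

(** Near z, a line in the direction of z passes from near (1 - e) z, where the
    matrix is positive definite, to near (1 + e) z, where it is not
    semidefinite; so it meets the boundary, and it does so near z. *)
Lemma psd_boundary_crossing z (W : set 'rV[R]_m) :
  psd_boundary A z -> nbhs z W ->
  exists2 r, 0 < r & forall y : 'rV[R]_m,
    (forall s, `|y ord0 s - z ord0 s| < r) ->
    exists2 t, W (y + t *: z) & psd_boundary A (y + t *: z).
Proof.
move=> zb /nbhs_row [r1 r10 hW].
pose K := \sum_s `|z ord0 s|.
have K0 : 0 <= K by apply: sumr_ge0 => i _; exact: normr_ge0.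
(* e < 1 makes (1 - e) z an interior point, and e K < r1 / 2 keeps the segment
   of half-length e inside W. *)
pose e := r1 / (r1 + 2 * (1 + K)).
have d0 : 0 < r1 + 2 * (1 + K) by lra.
have e0 : 0 < e by rewrite divr_gt0.
have e1 : e < 1 by rewrite ltr_pdivrMr // mul1r; lra.
have eK : e * K < r1 / 2.
  by rewrite /e mulrAC ltr_pdivrMr // ; nra.
clearbody e.
have pdz : pd_set A ((1 - e) *: z).
  by apply: psd_set_star => //; [case: zb|apply/andP; split; lra].
have [v hv] := psd_boundary_exterior A_star zb e0.
have /nbhs_row [r2 r20 h2] : nbhs ((1 - e) *: z) (pd_set A).
  by apply: open_nbhs_nbhs; split=> //; exact: pd_set_open.
have /nbhs_row [r3 r30 h3] : nbhs ((1 + e) *: z)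
    [set x | qform (mpolymx_at A x) v < 0].
  have : nbhs (qform (mpolymx_at A ((1 + e) *: z)) v) [set t | t < 0].
    exact: lt_nbhsl.
  by move=> /(qform_at_continuous (A := A)).
pose r := Num.min (r1 / 2) (Num.min r2 r3).
have r0 : 0 < r by rewrite !lt_min r20 r30 divr_gt0.
exists r => // y hy.
have hy1 s : `|y ord0 s - z ord0 s| < r1 / 2.
  by have := hy s; rewrite !lt_min => /andP[].
have hy2 s : `|y ord0 s - z ord0 s| < r2.
  by have := hy s; rewrite !lt_min => /and3P[].
have hy3 s : `|y ord0 s - z ord0 s| < r3.
  by have := hy s; rewrite !lt_min => /and3P[].
have pl : pd_set A (y - e *: z).
  apply: h2 => s; rewrite !mxE [X in `|X|](_ : _ = y ord0 s - z ord0 s) //.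
  by ring.
have nr : ~ pd_set A (y + e *: z).
  move=> /pdmxW [_ /(_ v)]; apply/negP; rewrite -ltNge; apply: h3 => s.
  rewrite !mxE [X in `|X|](_ : _ = y ord0 s - z ord0 s) //.
  by ring.
apply: contrapT => none; apply: nr.
have sub := connected_sub_pd_set A_sym
  (@segment_set_connected R m (y - e *: z) (y + e *: z))
  (segment_set_l _ _) pl.
apply: sub; last exact: segment_set_r.
move=> _ [t + <-] b; rewrite /= in_itv /= => /andP[t0 t1].
have E : y - e *: z + t *: (y + e *: z - (y - e *: z))
         = y + (e * (2 * t - 1)) *: z.
    by apply/rowP => i; rewrite !mxE; ring.
rewrite E in b; apply: none; exists (e * (2 * t - 1)) => //.
apply: hW => s; rewrite !mxE addrAC; apply: le_lt_trans (ler_normD _ _) _.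
have : `|e * (2 * t - 1) * z ord0 s| <= e * K.
    rewrite !normrM (gtr0_norm e0) -mulrA; apply: ler_wpM2l; first exact: ltW.
    apply: le_trans (entry_le_norm1 z s); rewrite ler_piMl // ler_norml.
    by apply/andP; split; lra.
by have := hy1 s; lra.
Qed.

Lemma det_at0 : mpoly_at (\det A) 0 = 1.
Proof. by rewrite -mpolymx_at_det mpolymx_at0 // det1. Qed.

Lemma det_mpoly_neq0 : \det A != 0.
Proof.
apply/eqP => h; have := det_at0; rewrite h /mpoly_at meval0 => /eqP.
by rewrite eq_sym oner_eq0.
Qed.

(** The polynomial h is a greatest common divisor of the determinant and f. *)
Lemma vanishing_common_factor (f : mpoly m R) :
  (forall x, psd_boundary A x -> mpoly_at f x = 0) ->
  exists h, [/\ defining_poly (psd_set A) h, divides h (\det A) & divides h f].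
Proof.
move=> fb; have [h [a [b [ed ef cop]]]] := maximal_common_divisor f det_mpoly_neq0.
have a0 : a != 0 by apply: contraNneq det_mpoly_neq0 => e; rewrite ed e mul0r.
have hb z : psd_boundary A z -> mpoly_at h z = 0.
  move=> zb; apply: contrapT => /eqP hz.
  have hW : nbhs z [set x | mpoly_at h x != 0].
    apply: (@mpoly_at_continuous R m h z [set t | t != 0]).
    apply: open_nbhs_nbhs; split=> //; exact: open_neq.
  have [r r0 hr] := psd_boundary_crossing zb hW.
  (* Near z, the boundary points are zeros of both cofactors a and b. *)
  have [c c0 hc] := coprime_elimination (fun s => z ord0 s) a0 cop.
  move: c0; rewrite (_ : c = 0) ?eqxx //.
  apply: (mpoly_eq0_near (a := fun s => z ord0 s) r0) => y hy.
  have [|t ht bt] := hr (\row_s y s); first by move=> s; rewrite mxE.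
  have eW p : p.@[fun i => y i + t * z ord0 i]
            = mpoly_at p (\row_s y s + t *: z).
    by apply: meval_eq => i; rewrite !mxE.
  apply: (hc _ t); rewrite eW.
    have := bt.2; rewrite mpolymx_at_det ed mpoly_atM => /eqP.
    by rewrite mulf_eq0 (negPf ht) orbF => /eqP.
  have := fb _ bt; rewrite ef mpoly_atM => /eqP.
  by rewrite mulf_eq0 (negPf ht) orbF => /eqP.
have hn x : pd_set A x -> mpoly_at h x != 0.
  move=> /pdmx_det_neq0; rewrite mpolymx_at_det ed mpoly_atM mulf_eq0.
  by case/norP.
have h00 := hn _ (pd_set0 A_star).
exists ((mpoly_at h 0)^-1 *: h); split.
- have hE x : mpoly_at ((mpoly_at h 0)^-1 *: h) x = mpoly_at h x / mpoly_at h 0.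
    by rewrite {1}/mpoly_at mevalZ mulrC.
  apply: defining_poly_of_pos => // x px; rewrite hE; last first.
    by rewrite hb // mul0r.
  have [P hP] := line_poly h 0 x.
  (* A change of sign on the segment from 0 to x would produce a zero. *)
  rewrite ltNge; apply/negP => hx.
  have [||t tI /rootP] := @poly_ivt R (- (mpoly_at h 0)^-1 *: P) 0 1.
  + exact: ler01.
  + rewrite !hornerZ !hP scale0r !add0r scale1r mulNr mulVf // oppr_le0 ler01 /=.
    by rewrite mulNr oppr_ge0 mulrC.
  rewrite hornerZ hP add0r => /eqP; apply/negP; rewrite mulf_neq0 //.
    by rewrite oppr_eq0 invr_eq0.
  by apply/hn/pd_set_star => //; rewrite -in_itv.
- exists (mpoly_at h 0 *: a); rewrite -scalerAl -scalerAr scalerA mulfV //.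
  by rewrite scale1r.
- exists (mpoly_at h 0 *: b); rewrite -scalerAl -scalerAr scalerA mulfV //.
  by rewrite scale1r.
Qed.

Lemma vanishing_poly_degree (d : nat) :
  (forall q, defining_poly (psd_set A) q -> (d <= tdeg q)%N) ->
  forall f : mpoly m R, f != 0 ->
    (forall x, psd_boundary A x -> mpoly_at f x = 0) -> (d <= tdeg f)%N.
Proof.
move=> hd f f0 fb; have [h [hdef _ hf]] := vanishing_common_factor fb.
apply: leq_trans (hd _ hdef) _; rewrite /tdeg -!subn1 leq_sub2r //.
exact: msize_divides_le.
Qed.

Lemma min_degree_det_divides (f : mpoly m R) :
  min_degree_defining_poly (psd_set A) (\det A) ->
  (forall x, psd_boundary A x -> mpoly_at f x = 0) -> divides (\det A) f.
Proof.
move=> [_ hmin] fb; have [h [hdef [a ea] hf]] := vanishing_common_factor fb.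
have h0 : h != 0.
  by apply: contraNneq det_mpoly_neq0 => e; rewrite ea e mulr0.
have a0 : a != 0.
  by apply: contraNneq det_mpoly_neq0 => e; rewrite ea e mul0r.
have a1 : (msize a <= 1)%N.
  have := hmin _ hdef; rewrite /tdeg ea msizeM //.
  rewrite (mpolySpred _ h0) (mpolySpred _ a0) addSn addnS /=.
  by rewrite -[X in (_ <= X)%N]add0n leq_add2r leqn0 => /eqP ->.
have ea1 := msize1_polyC a1.
have c0 : a@_0 != 0.
  by apply: contraNneq a0 => e; rewrite ea1 e mpolyC0.
apply: divides_trans hf; exists (a@_0)^-1%:MP.
by rewrite ea ea1 mulrA -mpolyCM mcoeffC eqxx mulr1 mulVf // mpolyC1 mul1r.
Qed.

End BoundaryPolynomials.

(** * Vanishing conditions on disjoint blocks of variables *)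

Lemma meval_sum (R : comNzRingType) (n : nat) (y : 'I_n -> R) (I : Type)
    (r : seq I) (P : pred I) (F : I -> mpoly n R) :
  (\sum_(i <- r | P i) F i).@[y] = \sum_(i <- r | P i) (F i).@[y].
Proof. exact: (raddf_sum (meval y)). Qed.

Section VariableBlock.
Variables (R : realType) (m n : nat) (iota : 'I_m -> 'I_n).
Hypothesis iota_inj : injective iota.
Implicit Types (p : mpoly n R) (u : 'X_{1..n}) (x : 'I_m -> R) (X : 'I_n -> R).

Let J := [set iota i | i : 'I_m]%SET.

Definition mnm_in u : 'X_{1..m} := [multinom u (iota i) | i < m].
Definition mnm_out u : 'X_{1..n} := [multinom if s \in J then 0%N else u s | s < n].

(** The coefficient of X^mu, where p is read as a polynomial in the variables
    of the block. *)
Definition coef_in p (mu : 'X_{1..m}) : mpoly n R :=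
  \sum_(u <- msupp p | mnm_in u == mu) p@_u *: 'X_[mnm_out u].

(** The coefficient of X^alpha, where p is read as a polynomial in the
    variables outside of the block. *)
Definition coef_out p (alpha : 'X_{1..n}) : mpoly m R :=
  \sum_(u <- msupp p | mnm_out u == alpha) p@_u *: 'X_[mnm_in u].

Definition set_block X x : 'I_n -> R :=
  fun s => if [pick i | iota i == s] is Some i then x i else X s.

Lemma set_block_in X x i : set_block X x (iota i) = x i.
Proof.
rewrite /set_block; case: pickP => [j /eqP /iota_inj -> //|/(_ i)].
by rewrite eqxx.
Qed.

Lemma set_block_out X x s : s \notin J -> set_block X x s = X s.
Proof.
rewrite /set_block => sJ; case: pickP => // i /eqP e.
by move: sJ; rewrite -e imset_f.
Qed.

Lemma big_split_block (T : Type) (idx : T) (op : Monoid.com_law idx)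
    (F : 'I_n -> T) :
  \big[op/idx]_s F s
    = op (\big[op/idx]_i F (iota i)) (\big[op/idx]_(s | s \notin J) F s).
Proof.
rewrite (bigID (mem J)) /=; congr (op _ _).
rewrite big_imset /=; last by move=> ? ? _ _; apply: iota_inj.
by apply: eq_bigl => i; rewrite inE.
Qed.

Lemma mnm_in_out_inj u u' :
  mnm_in u = mnm_in u' -> mnm_out u = mnm_out u' -> u = u'.
Proof.
move=> /mnmP hin /mnmP hout; apply/mnmP => s.
have := hout s; rewrite !mnmE; case: ifPn => // /imsetP[i _ ->] _.
by have := hin i; rewrite !mnmE.
Qed.

Lemma mdeg_in_out u : mdeg u = (mdeg (mnm_in u) + mdeg (mnm_out u))%N.
Proof.
rewrite !mdegE (big_split_block addn); congr (_ + _)%N.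
  by apply: eq_bigr => i _; rewrite mnmE.
rewrite big_mkcond; apply: eq_bigr => s _; rewrite mnmE.
by case: (s \in J).
Qed.

Lemma meval_set_block p X x :
  p.@[set_block X x] =
  \sum_(u <- msupp p) p@_u * (\prod_i x i ^+ mnm_in u i)
                           * (\prod_s X s ^+ mnm_out u s).
Proof.
rewrite mevalE; apply: eq_bigr => u _; rewrite -mulrA; congr (_ * _).
rewrite (big_split_block *%R); congr (_ * _).
  by apply: eq_bigr => i _; rewrite set_block_in mnmE.
rewrite big_mkcond; apply: eq_bigr => s _; rewrite mnmE.
by have [sJ|sJ] := boolP (s \in J); rewrite /= ?expr0 // set_block_out.
Qed.

(** A polynomial that vanishes as a function has zero coefficients; the map f
    need not be injective, so that each coefficient is a sum. *)
Lemma grouped_coef_eq0 (k : nat) (r : seq 'X_{1..n}) (c : 'X_{1..n} -> R)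
    (f : 'X_{1..n} -> 'X_{1..k}) :
  (forall y : 'I_k -> R, \sum_(u <- r) c u * (\prod_i y i ^+ f u i) = 0) ->
  forall v, \sum_(u <- r | f u == v) c u = 0.
Proof.
move=> h v.
have e : \sum_(u <- r) c u *: 'X_[f u] = 0 :> mpoly k R.
  apply: mpoly_eq0_fun => y; rewrite -[RHS](h y) meval_sum; apply: eq_bigr => u _.
  by rewrite mevalZ mevalX.
have /(congr1 (mcoeff v)) := e; rewrite mcoeff0 raddf_sum /= => e'.
rewrite -[RHS]e' big_mkcond; apply: eq_bigr => u _; rewrite mcoeffZ mcoeffX.
by case: eqP; rewrite ?mulr1 ?mulr0.
Qed.

Lemma coef_out_eq0 p x :
  (forall X, p.@[set_block X x] = 0) -> forall alpha, (coef_out p alpha).@[x] = 0.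
Proof.
move=> h alpha.
rewrite -[RHS](@grouped_coef_eq0 n (msupp p)
  (fun u => p@_u * \prod_i x i ^+ mnm_in u i) mnm_out _ alpha); last first.
  by move=> X; rewrite -meval_set_block.
by rewrite rmorph_sum; apply: eq_bigr => u _; rewrite /= mevalZ mevalX.
Qed.

Lemma coef_in_eq0 p X :
  (forall x, p.@[set_block X x] = 0) -> forall mu, (coef_in p mu).@[X] = 0.
Proof.
move=> h mu.
rewrite -[RHS](@grouped_coef_eq0 m (msupp p)
  (fun u => p@_u * \prod_s X s ^+ mnm_out u s) mnm_in _ mu); last first.
  move=> x; rewrite -[RHS](h x) meval_set_block.
  by apply: eq_bigr => u _; rewrite mulrAC.
by rewrite rmorph_sum; apply: eq_bigr => u _; rewrite /= mevalZ mevalX.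
Qed.

Lemma mcoeff_grouped (k : nat) (P : pred 'X_{1..n}) (f : 'X_{1..n} -> 'X_{1..k})
    p u :
  P u -> (forall u', P u' -> f u' = f u -> u' = u) ->
  (\sum_(u' <- msupp p | P u') p@_u' *: 'X_[f u'])@_(f u) = p@_u.
Proof.
move=> Pu fI; rewrite raddf_sum /=.
rewrite (eq_bigr (fun u' => p@_u' * (u' == u)%:R)) => [|u' Pu'].
  have [up|up] := boolP (u \in msupp p).
    rewrite -big_filter (bigD1_seq u) ?filter_uniq ?mem_filter ?Pu ?msupp_uniq //=.
    by rewrite eqxx mulr1 big1 ?addr0 // => u' /negPf ->; exact: mulr0.
  rewrite (memN_msupp_eq0 up) big_seq_cond big1 // => u' /andP[u'p _].
  by case: eqP up => [<-|]; rewrite ?u'p ?mulr0.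
rewrite mcoeffZ mcoeffX; congr (_ * (nat_of_bool _)%:R).
by apply/eqP/eqP => [h|->//]; apply: fI.
Qed.

Lemma coef_out_mnm_in p u : (coef_out p (mnm_out u))@_(mnm_in u) = p@_u.
Proof.
apply: mcoeff_grouped => // u' /eqP hout hin; exact: mnm_in_out_inj hin hout.
Qed.

Lemma coef_in_mnm_out p u : (coef_in p (mnm_in u))@_(mnm_out u) = p@_u.
Proof. by apply: mcoeff_grouped => // u' /eqP; apply: mnm_in_out_inj. Qed.

Lemma mdeg_le_tdeg p u : u \in msupp p -> (mdeg u <= tdeg p)%N.
Proof. by move=> /msize_mdeg_lt; rewrite /tdeg; case: (msize p). Qed.

Lemma msupp_sum_ex (k : nat) (r : seq 'X_{1..n}) (P : pred 'X_{1..n})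
    (c : 'X_{1..n} -> R) (f : 'X_{1..n} -> 'X_{1..k}) v :
  v \in msupp (\sum_(u <- r | P u) c u *: 'X_[f u]) ->
  exists2 u, u \in r & P u /\ f u = v.
Proof.
rewrite mcoeff_msupp => h; apply: contrapT => none; move/negP: h; apply.
rewrite raddf_sum /= big_seq_cond big1 // => u /andP[ur Pu].
rewrite mcoeffZ mcoeffX; case: eqP => [e|_]; last by rewrite mulr0.
by case: none; exists u.
Qed.

(** Some coefficient c of p, as a polynomial in the other variables, is not
    zero, and it vanishes on S, hence has a monomial mu of degree at least d.
    Then the coefficient of mu in p is not zero, and has degree at most
    deg p - deg mu. *)
Lemma block_degree_step (S : ('I_m -> R) -> Prop) (d : nat) p :
  (forall f : mpoly m R, f != 0 -> (forall x, S x -> f.@[x] = 0) ->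
     (d <= tdeg f)%N) ->
  p != 0 -> (forall X, S (X \o iota) -> p.@[X] = 0) ->
  exists mu, coef_in p mu != 0 /\ (tdeg (coef_in p mu) + d <= tdeg p)%N.
Proof.
move=> hS p0 pS; pose u0 := mlead p; pose c := coef_out p (mnm_out u0).
have c0 : c != 0.
  have : c@_(mnm_in u0) != 0 by rewrite coef_out_mnm_in mleadc_eq0.
  by apply: contraNneq => ->; rewrite mcoeff0.
have cS x : S x -> c.@[x] = 0.
  move=> Sx; apply: coef_out_eq0 => X; apply: pS.
  suff -> : set_block X x \o iota = x by [].
  by apply/funext => i; rewrite /= set_block_in.
have dc := hS c c0 cS.
have [u1 u1p [hout hin]] := msupp_sum_ex (mlead_supp c0).
pose q := coef_in p (mlead c).
have q0 : q != 0.
  have : q@_(mnm_out u1) != 0.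
    by rewrite /q -hin coef_in_mnm_out -mcoeff_msupp.
  by apply: contraNneq => ->; rewrite mcoeff0.
exists (mlead c); split=> //.
have [u2 u2p [/eqP h2in h2out]] := msupp_sum_ex (mlead_supp q0).
have := mdeg_le_tdeg u2p; rewrite mdeg_in_out h2in h2out addnC.
apply: leq_trans; rewrite /tdeg -/q -(mlead_deg q0) /= leq_add2l.
by move: dc; rewrite /tdeg -(mlead_deg c0).
Qed.

End VariableBlock.

(** Removing the blocks one by one is possible because taking a coefficient in
    one block preserves the vanishing conditions on the others. *)
Lemma blocks_degree (R : realType) (m N n : nat) (iota : 'I_n -> 'I_m -> 'I_N)
    (S : ('I_m -> R) -> Prop) (d : nat) (p : mpoly N R) :
  (forall j i j' i', iota j i = iota j' i' -> j = j' /\ i = i') ->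
  (forall f : mpoly m R, f != 0 -> (forall x, S x -> f.@[x] = 0) ->
     (d <= tdeg f)%N) ->
  p != 0 -> (forall j X, S (X \o iota j) -> p.@[X] = 0) ->
  (n * d <= tdeg p)%N.
Proof.
move=> iI hS p0 pS.
have iotaI j : injective (iota j) by move=> i i' /iI [].
suff aux (js : seq 'I_n) (q : mpoly N R) : uniq js -> q != 0 ->
    (forall j X, j \in js -> S (X \o iota j) -> q.@[X] = 0) ->
    (size js * d <= tdeg q)%N.
  rewrite -{1}(size_enum_ord n); apply: aux; rewrite ?enum_uniq //.
  by move=> j X _; apply: pS.
elim: js q => [|j js IHjs] q; first by rewrite mul0n.
move=> /= /andP[jjs js_uniq] q0 qS.
have [|mu [r0 dr]] := @block_degree_step R m N (iota j) (iotaI j) S d q hS q0.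
  by move=> X; apply: qS; rewrite mem_head.
rewrite mulSn addnC; apply: leq_trans dr; rewrite leq_add2r.
apply: IHjs => // j' X j'js SX; apply: coef_in_eq0 => // x.
apply: (qS j'); first by rewrite in_cons j'js orbT.
suff -> : set_block (iota j) X x \o iota j' = X \o iota j' by [].
apply/funext => i /=; apply: set_block_out; apply/imsetP => -[i' _ /iI [e _]].
by move: jjs; rewrite -e j'js.
Qed.

(** * Degrees of determinants *)

Section TotalDegree.
Variables (R : realType) (m : nat).
Implicit Types (p q : mpoly m R).

Lemma tdeg_leP p d :
  reflect (forall u, u \in msupp p -> (mdeg u <= d)%N) (tdeg p <= d)%N.
Proof.
apply: (iffP idP) => [h u /mdeg_le_tdeg|h]; first by move/leq_trans; apply.
have [->|p0] := eqVneq p 0; first by rewrite /tdeg msize0.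
by rewrite /tdeg -(mlead_deg p0) /= h // mlead_supp.
Qed.

Lemma tdegC c : tdeg (c%:MP : mpoly m R) = 0%N.
Proof. by rewrite /tdeg msizeC; case: (c != 0). Qed.

Lemma tdegM_le p q : (tdeg (p * q)%R <= tdeg p + tdeg q)%N.
Proof.
have [->|p0] := eqVneq p 0; first by rewrite mul0r /tdeg msize0.
have [->|q0] := eqVneq q 0; first by rewrite mulr0 /tdeg msize0.
rewrite /tdeg msizeM // (mpolySpred _ p0) (mpolySpred _ q0).
by rewrite addSn addnS.
Qed.

Lemma tdegD_le p q d :
  (tdeg p <= d)%N -> (tdeg q <= d)%N -> (tdeg (p + q)%R <= d)%N.
Proof.
move=> /tdeg_leP hp /tdeg_leP hq; apply/tdeg_leP => u /msuppD_le.
by rewrite mem_cat => /orP[/hp|/hq].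
Qed.

Lemma tdeg_sum_le (I : Type) (r : seq I) (P : pred I) (F : I -> mpoly m R) d :
  (forall i, P i -> (tdeg (F i) <= d)%N) ->
  (tdeg (\sum_(i <- r | P i) F i)%R <= d)%N.
Proof.
move=> h; elim/big_rec: _ => [|i p /h]; first by rewrite /tdeg msize0.
exact: tdegD_le.
Qed.

Lemma tdeg_prod_le (I : finType) (F : I -> mpoly m R) (d : I -> nat) :
  (forall i, (tdeg (F i) <= d i)%N) ->
  (tdeg (\prod_i F i)%R <= \sum_i d i)%N.
Proof.
move=> h; elim/big_rec2: _ => [|i k p _ hp].
  by rewrite (_ : 1 = 1%:MP) // tdegC.
by apply: leq_trans (tdegM_le _ _) _; apply: leq_add.
Qed.

(** In each term of the Leibniz expansion, every row and every column is used
    once. *)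
Lemma tdeg_det_le (N : nat) (A : 'M[mpoly m R]_N) (r c : 'I_N -> nat) :
  (forall i j, (tdeg (A i j) <= r i + c j)%N) ->
  (tdeg (\det A) <= \sum_i r i + \sum_j c j)%N.
Proof.
move=> h; apply: tdeg_sum_le => s _.
apply: leq_trans (tdegM_le _ _) _.
have -> : tdeg ((-1) ^+ s : mpoly m R) = 0%N.
  by rewrite -mpolyC1 -mpolyCN -(rmorphXn (@mpolyC m R)) tdegC.
have hprod := tdeg_prod_le (fun i => h i (s i)).
rewrite add0n; apply: leq_trans hprod _.
by rewrite big_split /= leq_add2l [leqRHS](reindex_inj (@perm_inj _ s)) /=.
Qed.

Lemma ray_poly (p : mpoly m R) (v : 'rV[R]_m) :
  exists2 P : {poly R}, (size P <= (tdeg p).+1)%N &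
    forall t, P.[t] = mpoly_at p (t *: v).
Proof.
exists (\sum_(u <- msupp p) (p@_u * \prod_i v ord0 i ^+ u i) *: 'X^(mdeg u)).
  rewrite big_seq; elim/big_rec: _ => [|u P up hP]; first by rewrite size_poly0.
  rewrite (leq_trans (size_polyD _ _)) // geq_max hP andbT.
  apply: leq_trans (size_scale_leq _ _) _.
  by rewrite size_polyXn ltnS mdeg_le_tdeg.
move=> t; rewrite horner_sum /mpoly_at mevalE; apply: eq_bigr => u _.
rewrite hornerZ hornerXn -mulrA; congr (_ * _).
under [RHS]eq_bigr => i _ do rewrite mxE exprMn.
by rewrite big_split /= mulrC mdegE -expr_sum.
Qed.

End TotalDegree.

(** * Evaluation of noncommutative polynomials *)

Section PolynomialEvaluation.
Variables (R S : comNzRingType) (f : {additive R -> S}).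
Variables (g n : nat) (X : mxpoint S g n).

(** Evaluation and involution of noncommutative polynomials are both sums over
    the support of terms that are additive in the coefficient; this and the next
    lemma are the common reason why they are additive and known on monomials. *)
Lemma malg_sumD (K : choiceType) (G V : zmodType) (phi : K -> G -> V)
    (p q : {malg G[K]}) :
  (forall k, {morph phi k : x y / x + y}) -> (forall k, phi k 0 = 0) ->
  \sum_(k <- monalg.msupp (p + q)) phi k (monalg.mcoeff k (p + q)) =
  \sum_(k <- monalg.msupp p) phi k (monalg.mcoeff k p) +
  \sum_(k <- monalg.msupp q) phi k (monalg.mcoeff k q).
Proof.
move=> phiD phi0.
have incl (r : {malg G[K]}) (d : {fset K}) : (monalg.msupp r `<=` d)%fset ->
    \sum_(k <- monalg.msupp r) phi k (monalg.mcoeff k r)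
    = \sum_(k <- d) phi k (monalg.mcoeff k r).
  by move=> rd; apply: big_fset_incl => // k _ /mcoeff_outdom ->.
rewrite (incl _ _ (monalg.msuppD_le p q)) (incl p _ (fsubsetUl _ (monalg.msupp q))).
rewrite (incl q _ (fsubsetUr (monalg.msupp p) _)) -big_split /=.
by apply: eq_bigr => k _; rewrite monalg.mcoeffD phiD.
Qed.

Lemma malg_sumU (K : choiceType) (G V : zmodType) (phi : K -> G -> V) k x :
  (forall k, phi k 0 = 0) ->
  \sum_(k' <- monalg.msupp (monalg.mkmalgU k x))
     phi k' (monalg.mcoeff k' (monalg.mkmalgU k x)) = phi k x.
Proof.
move=> phi0; rewrite monalg.msuppU; case: eqVneq => [->|_].
  by rewrite big_seq_fset0 phi0.
by rewrite big_seq_fset1 mcoeffUU.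
Qed.

Lemma map_mx_tensD (k l p q : nat) (B : 'M[S]_(p, q)) :
  {morph (fun A : 'M[R]_(k, l) => tensmx (map_mx f A) B) : A A' / A + A'}.
Proof. by move=> A A'; apply/matrixP => i j; rewrite !mxE raddfD mulrDl. Qed.

Lemma map_mx_tens0 (k l p q : nat) (B : 'M[S]_(p, q)) :
  tensmx (map_mx f (0 : 'M[R]_(k, l))) B = 0.
Proof. by apply/matrixP => i j; rewrite !mxE raddf0 mul0r. Qed.

Lemma mxnc_eval_inD (k l : nat) :
  {morph (fun p : mxncpoly R k l g => mxnc_eval_in f p X) : p q / p + q}.
Proof.
move=> p q; apply: (@malg_sumD _ _ _
  (fun w A => tensmx (map_mx f A) (word_eval X w))) => w.
  exact: map_mx_tensD.
exact: map_mx_tens0.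
Qed.

Lemma mxnc_eval_inU (k l : nat) (w : word g) (A : 'M[R]_(k, l)) :
  mxnc_eval_in f (monalg.mkmalgU w A) X = tensmx (map_mx f A) (word_eval X w).
Proof.
apply: (@malg_sumU _ _ _
  (fun w A => tensmx (map_mx f A) (word_eval X w))) => w'.
exact: map_mx_tens0.
Qed.

Lemma mxnc_eval_in0 (k l : nat) :
  mxnc_eval_in f (0 : mxncpoly R k l g) X = 0.
Proof. by rewrite /mxnc_eval_in monalg.msupp0 big_seq_fset0. Qed.

Lemma mxnc_eval_in_sum (k l : nat) (I : Type) (r : seq I)
    (F : I -> mxncpoly R k l g) :
  mxnc_eval_in f (\sum_(i <- r) F i) X = \sum_(i <- r) mxnc_eval_in f (F i) X.
Proof.
exact: (big_morph (fun p => mxnc_eval_in f p X)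
  (@mxnc_eval_inD k l) (mxnc_eval_in0 k l)).
Qed.

Lemma word_eval_cat (s t : seq (letter g)) :
  word_eval X (FMonom (s ++ t)) = word_eval X (FMonom s) *m word_eval X (FMonom t).
Proof.
rewrite /word_eval /=; elim: s => [|a s IHs] /=; first by rewrite mul1mx.
by rewrite IHs mulmxA.
Qed.

Lemma tr_word_eval (w : word g) : (word_eval X w)^T = word_eval X (word_star w).
Proof.
case: w => s; rewrite /word_star /=; elim: s => [|a s IHs].
  by rewrite /word_eval /= trmx1.
rewrite rev_cons map_rcons -cats1 word_eval_cat -IHs /word_eval /= mulmx1.
rewrite trmx_mul; congr (_ *m _).
by rewrite /letter_eval /=; case: a.2; rewrite ?trmxK.
Qed.

End PolynomialEvaluation.

Lemma mxtupleE (T : Type) (g n : nat) (X : mxpoint T g n) i a b :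
  mxtuple X i a b = X ord0 (mxvec_index i (mxvec_index a b)).
Proof. by rewrite /mxtuple !mxE. Qed.

Lemma map_word_eval (R S : comNzRingType) (h : {rmorphism R -> S}) (g n : nat)
    (X : mxpoint R g n) (w : word g) :
  map_mx h (word_eval X w) = word_eval (map_mx h X) w.
Proof.
case: w => s; rewrite /word_eval /=; elim: s => [|a s IHs] /=.
  by rewrite map_mx1.
rewrite map_mxM IHs; congr (_ *m _); apply/matrixP => i j.
by rewrite /letter_eval; case: a.2; rewrite !mxE.
Qed.

Definition generic_mx (R : comNzRingType) (k l g : nat) (p : mxncpoly R k l g)
    (n : nat) : 'M[mpoly (g * (n * n)) R]_(k * n, l * n) :=
  mxnc_eval_in (@mpolyC _ R) p (\row_s 'X_s).

Lemma generic_mx_at (R : realType) (k l g n : nat) (p : mxncpoly R k l g)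
    (x : mxpoint R g n) :
  \matrix_(i, j) mpoly_at (generic_mx p n i j) x = mxnc_eval p x.
Proof.
pose h : {rmorphism mpoly (g * (n * n)) R -> R} := meval (fun s => x ord0 s).
have -> : \matrix_(i, j) mpoly_at (generic_mx p n i j) x
        = map_mx h (generic_mx p n) by apply/matrixP => i j; rewrite !mxE.
have hx : map_mx h (\row_s 'X_s) = x.
  by apply/rowP => s; rewrite !mxE [LHS]mevalXU.
rewrite /mxnc_eval /generic_mx /mxnc_eval_in raddf_sum /=; apply: eq_bigr => w _.
rewrite (map_mxT h) map_word_eval hx; congr (tensmx _ _).
by apply/matrixP => i j; rewrite !mxE [LHS]mevalC.
Qed.

Lemma tdeg_word_eval (R : realType) (g n : nat) (w : word g) i j :
  (tdeg (word_eval (\row_s ('X_s : mpoly (g * (n * n)) R)) w i j) <= fdeg w)%N.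
Proof.
rewrite fdegE; case: w => s; rewrite /word_eval /=.
elim: s i j => [|a s IHs] i j /=.
  by rewrite mxE -mulr_natr -mpolyC_nat mul1r tdegC.
rewrite mxE; apply: tdeg_sum_le => k _; apply: leq_trans (tdegM_le _ _) _.
rewrite -[(size s).+1]add1n; apply: leq_add; last exact: IHs.
by rewrite /letter_eval; case: a.2; rewrite !mxE /tdeg msizeX mdeg1.
Qed.

(** Separate weights for rows and columns serve two cases: r = 1 and c = 0 give
    the bound n l for all pencils, and the indicators of the first row and of
    the first column give 2 n for the free ball. *)
Lemma tdeg_pencil_det_le (R : realType) (l g n : nat) (L : mxncpoly R l l g)
    (r c : 'I_l -> nat) :
  (forall w i j, monalg.mcoeff w L i j != 0 -> (fdeg w <= r i + c j)%N) ->
  (tdeg (pencil_det L n) <= n * (\sum_i r i + \sum_j c j))%N.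
Proof.
move=> h.
have sumE (F : 'I_l -> nat) :
    (\sum_(k < l * n) F (mxtens_unindex k).1 = n * \sum_i F i)%N.
  rewrite (reindex (@mxtens_index l n)); last first.
    by exists (@mxtens_unindex l n) => k _; rewrite ?mxtens_indexK ?mxtens_unindexK.
  under eq_bigr do rewrite mxtens_indexK.
  rewrite -(pair_bigA _ (fun i _ => F i)) /= big_distrr /=.
  by apply: eq_bigr => i _; rewrite sum_nat_const card_ord.
rewrite mulnDr -!sumE; apply: tdeg_det_le => i j.
rewrite /mxnc_eval_in summxE; apply: tdeg_sum_le => w _; rewrite !mxE.
have [->|a0] := eqVneq (monalg.mcoeff w L (mxtens_unindex i).1
  (mxtens_unindex j).1) 0; first by rewrite mpolyC0 mul0r /tdeg msize0.
apply: leq_trans (tdegM_le _ _) _; rewrite tdegC add0n.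
have hw := tdeg_word_eval R w (mxtens_unindex i).2 (mxtens_unindex j).2.
exact: leq_trans hw (h _ _ _ a0).
Qed.

(** * Involution and evaluation at real tuples *)

Lemma map_mx_idfun (R : nzRingType) (k l : nat) (A : 'M[R]_(k, l)) :
  map_mx (@idfun R) A = A.
Proof. by apply/matrixP => i j; rewrite mxE. Qed.

Lemma mxnc_evalE (R : nzRingType) (k l g n : nat) (p : mxncpoly R k l g)
    (X : mxpoint R g n) :
  mxnc_eval p X
    = \sum_(w <- monalg.msupp p) tensmx (monalg.mcoeff w p) (word_eval X w).
Proof. by apply: eq_bigr => w _; rewrite (map_mx_idfun (monalg.mcoeff w p)). Qed.

Lemma mxnc_evalU (R : comNzRingType) (k l g n : nat) (X : mxpoint R g n)
    (w : word g) (A : 'M[R]_(k, l)) :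
  mxnc_eval (monalg.mkmalgU w A) X = tensmx A (word_eval X w).
Proof. by rewrite [LHS](mxnc_eval_inU (@idfun R)) map_mx_idfun. Qed.

Lemma mxnc_evalD (R : comNzRingType) (k l g n : nat) (X : mxpoint R g n)
    (p q : mxncpoly R k l g) :
  mxnc_eval (p + q) X = mxnc_eval p X + mxnc_eval q X.
Proof. exact: (mxnc_eval_inD (@idfun R)). Qed.

Lemma mxnc_eval_sum (R : comNzRingType) (k l g n : nat) (X : mxpoint R g n)
    (I : Type) (r : seq I) (F : I -> mxncpoly R k l g) :
  mxnc_eval (\sum_(i <- r) F i) X = \sum_(i <- r) mxnc_eval (F i) X.
Proof. exact: (mxnc_eval_in_sum (@idfun R)). Qed.

Lemma mxnc_starD (R : nzRingType) (k l g : nat) (p q : mxncpoly R k l g) :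
  mxnc_star (p + q) = mxnc_star p + mxnc_star q.
Proof.
apply: (@malg_sumD _ _ _
  (fun w (A : 'M[R]_(k, l)) => monalg.mkmalgU (word_star w) A^T)) => w.
  by move=> A A'; rewrite linearD monalgUD.
by rewrite trmx0 monalgU0.
Qed.

Lemma mxnc_starU (R : nzRingType) (k l g : nat) (w : word g) (A : 'M[R]_(k, l)) :
  mxnc_star (monalg.mkmalgU w A) = monalg.mkmalgU (word_star w) A^T.
Proof.
apply: (@malg_sumU _ _ _
  (fun w (A : 'M[R]_(k, l)) => monalg.mkmalgU (word_star w) A^T)) => w'.
by rewrite trmx0 monalgU0.
Qed.

Lemma mxnc_star0 (R : nzRingType) (k l g : nat) :
  mxnc_star (0 : mxncpoly R k l g) = 0.
Proof. by rewrite /mxnc_star monalg.msupp0 big_seq_fset0. Qed.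

Lemma mxnc_star_sum (R : nzRingType) (k l g : nat) (I : Type) (r : seq I)
    (F : I -> mxncpoly R k l g) :
  mxnc_star (\sum_(i <- r) F i) = \sum_(i <- r) mxnc_star (F i).
Proof.
exact: (big_morph (@mxnc_star R k l g) (@mxnc_starD R k l g) (mxnc_star0 R k l g)).
Qed.

Lemma mxnc_eval_star (R : comNzRingType) (k l g n : nat) (p : mxncpoly R k l g)
    (X : mxpoint R g n) :
  mxnc_eval (mxnc_star p) X = (mxnc_eval p X)^T.
Proof.
rewrite /mxnc_star mxnc_eval_sum mxnc_evalE raddf_sum /=.
by apply: eq_bigr => w _; rewrite mxnc_evalU trmx_tens tr_word_eval.
Qed.

Lemma tensmx11 (R : comNzRingType) (k n : nat) :
  tensmx (1%:M : 'M[R]_k) (1%:M : 'M[R]_n) = 1%:M.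
Proof.
apply/matrixP => i j; rewrite -(mxtens_unindexK i) -(mxtens_unindexK j).
case: (mxtens_unindex i) => i1 i2; case: (mxtens_unindex j) => j1 j2.
rewrite tensmxE !mxE (can_eq (@mxtens_indexK k n)) xpair_eqE.
by case: (i1 == j1); rewrite ?mul1r ?mul0r.
Qed.

Lemma tensmx_sumr (S : comNzRingType) (k l p q : nat) (I : finType)
    (F : I -> 'M[S]_(k, l)) (B : 'M[S]_(p, q)) :
  tensmx (\sum_i F i) B = \sum_i tensmx (F i) B.
Proof.
apply/matrixP => a b; rewrite mxE !summxE mulr_suml.
by apply: eq_bigr => i _; rewrite mxE.
Qed.

Lemma letter_evalZ (R : comNzRingType) (g n : nat) (t : R) (X : mxpoint R g n)
    (a : letter g) :
  letter_eval (t *: X) a = t *: letter_eval X a.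
Proof. by apply/matrixP => i j; rewrite /letter_eval; case: a.2; rewrite !mxE. Qed.

Lemma mxnc_eval_at0 (R : comNzRingType) (k l g n : nat) (p : mxncpoly R k l g) :
  mxnc_eval p (0 : mxpoint R g n) = tensmx (monalg.mcoeff (FMonom [::]) p) 1%:M.
Proof.
have letter0 a : letter_eval (0 : mxpoint R g n) a = 0.
  by rewrite -(scale0r (0 : mxpoint R g n)) letter_evalZ scale0r.
rewrite mxnc_evalE.
have e w : w != FMonom [::] -> word_eval (0 : mxpoint R g n) w = 0.
  case: w => -[|a s]; first by rewrite eqxx.
  by move=> _; rewrite /word_eval /= letter0 mul0mx.
have [in_p|nin_p] := boolP (FMonom [::] \in monalg.msupp p).
  rewrite (big_fsetD1 (FMonom [::])) //= [X in _ + X]big1_fset ?addr0 // => w.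
  by rewrite in_fsetD1 => /andP[/e -> _] _; rewrite tensmx0.
rewrite mcoeff_outdom // tens0mx big1_fset // => w wp _.
rewrite e ?tensmx0 //; apply: contraNneq nin_p => <-; exact: wp.
Qed.

(** * Monic pencils and tuples of diagonal matrices *)

(** The coordinate of a tuple of n x n matrices that is the j-th diagonal entry
    of the matrix with the same index as the 1 x 1 matrix of coordinate s. *)
Definition diag_index (g n : nat) (j : 'I_n) (s : 'I_(g * (1 * 1))) :
    'I_(g * (n * n)) :=
  mxvec_index (enum_val (cast_ord (esym (mxvec_cast g (1 * 1))) s)).1
              (mxvec_index j j).

Lemma diag_indexE (g n : nat) (j : 'I_n) (i : 'I_g) k :
  diag_index j (mxvec_index i k) = mxvec_index i (mxvec_index j j).
Proof. by rewrite /diag_index /mxvec_index cast_ordK enum_rankK. Qed.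

Lemma mxvec_index_inj (m n : nat) (i i' : 'I_m) (j j' : 'I_n) :
  mxvec_index i j = mxvec_index i' j' -> i = i' /\ j = j'.
Proof. by move/cast_ord_inj/enum_rank_inj => [-> ->]. Qed.

Lemma point1_indexP (g : nat) (s : 'I_(g * (1 * 1))) :
  exists i, s = mxvec_index i (mxvec_index ord0 ord0).
Proof.
case/mxvec_indexP: s => i k; exists i; congr mxvec_index.
by case/mxvec_indexP: k => a b; rewrite !ord1.
Qed.

Lemma diag_index_inj (g n : nat) (j j' : 'I_n) (s s' : 'I_(g * (1 * 1))) :
  diag_index j s = diag_index j' s' -> j = j' /\ s = s'.
Proof.
have [i ->] := point1_indexP s; have [i' ->] := point1_indexP s'.
by rewrite !diag_indexE => /mxvec_index_inj [-> /mxvec_index_inj [->]].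
Qed.

Definition diag_point (R : Type) (g n : nat) (X : mxpoint R g n) (j : 'I_n) :
    mxpoint R g 1 :=
  \row_s X ord0 (diag_index j s).

Definition is_diag_point (R : nzRingType) (g n : nat) (X : mxpoint R g n) :=
  forall i a b, a != b -> mxtuple X i a b = 0.

Section MonicPencil.
Variables (R : realType) (l g : nat) (L : mxncpoly R l l g).
Hypothesis monicL : monic_pencil L.

Lemma monic_pencil_sym n (X : mxpoint R g n) : (mxnc_eval L X)^T = mxnc_eval L X.
Proof. by case: monicL => sL _ _; rewrite -mxnc_eval_star sL. Qed.

(** The value at 0 only involves the coefficient of the empty word, which is the
    identity by the hypothesis at n = 1. *)
Lemma monic_pencil_at0 n : mxnc_eval L (0 : mxpoint R g n) = 1%:M.
Proof.
rewrite mxnc_eval_at0; suff -> : monalg.mcoeff (FMonom [::]) L = 1%:M.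
  exact: tensmx11.
case: monicL => _ _; rewrite mxnc_eval_at0 => /matrixP h.
apply/matrixP => i j; have := h (mxtens_index (i, ord0)) (mxtens_index (j, ord0)).
rewrite tensmxE !mxE eqxx mulr1 => ->.
by rewrite (can_eq (@mxtens_indexK l 1)) xpair_eqE eqxx andbT.
Qed.

Lemma monic_pencil_star n t (X : mxpoint R g n) :
  mxnc_eval L (t *: X) = (1 - t)%:M + t *: mxnc_eval L X.
Proof.
rewrite -scalemx1 -(monic_pencil_at0 n) !mxnc_evalE !scaler_sumr -big_split /=.
rewrite !big_seq; apply: eq_bigr => w wL.
have {wL} : (size w <= 1)%N by case: monicL => _ + _ => /(_ w wL).
case: w => -[|a [|//]] _; rewrite /word_eval /= ?mulmx1.
  by rewrite -scalerDl subrK scale1r.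
have -> : letter_eval (0 : mxpoint R g n) a = 0.
  by rewrite -(scale0r (0 : mxpoint R g n)) letter_evalZ scale0r.
rewrite letter_evalZ; apply/matrixP => i j.
by rewrite !mxE mulr0 mulr0 add0r mulrCA.
Qed.

Lemma generic_sym n x :
  (mpolymx_at (generic_mx L n) x)^T = mpolymx_at (generic_mx L n) x.
Proof. by rewrite /mpolymx_at generic_mx_at monic_pencil_sym. Qed.

Lemma generic_star n t x :
  mpolymx_at (generic_mx L n) (t *: x)
    = (1 - t)%:M + t *: mpolymx_at (generic_mx L n) x.
Proof. by rewrite /mpolymx_at !generic_mx_at monic_pencil_star. Qed.

Lemma pencil_setE n : pencil_set L n = psd_set (generic_mx L n).
Proof. by apply/funext => x; rewrite /psd_set /mpolymx_at /= generic_mx_at. Qed.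

Lemma pencil_interiorE n : pencil_interior L n = pd_set (generic_mx L n).
Proof.
rewrite -(component_pd_set_self (@generic_star n)); congr connected_component.
by apply/funext => x; rewrite /pd_set /mpolymx_at /= generic_mx_at.
Qed.

Lemma pencil_det_defining n : defining_poly (pencil_set L n) (pencil_det L n).
Proof.
rewrite pencil_setE.
exact: (det_defining_poly (@generic_sym n) (@generic_star n)).
Qed.

(** The summands are L(x_j) placed in the position of the j-th diagonal entry,
    where x_j is the point of the j-th diagonal entries. *)
Lemma diag_pencil_sum n (X : mxpoint R g n) : is_diag_point X ->
  mxnc_eval L X = \sum_j
    tensmx 1%:M (delta_mx j ord0) *m mxnc_eval L (diag_point X j)
      *m tensmx 1%:M (delta_mx ord0 j).
Proof.
move=> dX.
have word_sum w : (size (fmonom_val w) <= 1)%N -> word_eval X w = \sum_j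
    delta_mx j ord0 *m word_eval (diag_point X j) w *m delta_mx ord0 j.
  have deltaE (M : 'I_n -> 'M[R]_1) a b :
      (\sum_j delta_mx j ord0 *m M j *m delta_mx ord0 j) a b
      = (M a ord0 ord0) *+ (a == b).
    rewrite summxE (bigD1 a) //= big1 ?addr0 => [|j /negPf ja].
      rewrite !mxE big_ord1 !mxE big_ord1 !mxE !eqxx /= mul1r eq_sym.
      by rewrite mulr_natr.
    by rewrite !mxE big_ord1 !mxE big_ord1 !mxE eq_sym ja /= !mul0r.
  case: w => -[|a [|//]] _; apply/matrixP => p q; rewrite deltaE /word_eval /=.
    by rewrite !mxE eqxx.
  rewrite !mulmx1.
  have [<-|pq] := eqVneq p q.
    by rewrite mulr1n /letter_eval; case: a.2; rewrite !mxE diag_indexE.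
  rewrite mulr0n /letter_eval; case: a.2; first by rewrite mxE dX // eq_sym.
  exact: dX.
rewrite mxnc_evalE.
have e j : tensmx 1%:M (delta_mx j ord0) *m mxnc_eval L (diag_point X j)
      *m tensmx 1%:M (delta_mx ord0 j)
    = \sum_(w <- monalg.msupp L)
        tensmx (1%:M : 'M[R]_l) (delta_mx j ord0)
          *m tensmx (monalg.mcoeff w L) (word_eval (diag_point X j) w)
          *m tensmx (1%:M : 'M[R]_l) (delta_mx ord0 j).
  by rewrite mxnc_evalE mulmx_sumr mulmx_suml.
rewrite (eq_bigr _ (fun j _ => e j)).
rewrite exchange_big /= !big_seq; apply: eq_bigr => w wL.
have {wL} hw : (size w <= 1)%N by case: monicL => _ + _ => /(_ w wL).
rewrite (word_sum w hw).
have -> (A : 'M[R]_l) (F : 'I_n -> 'M[R]_n) :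
    tensmx A (\sum_j F j) = \sum_j tensmx A (F j).
  apply/matrixP => a b; rewrite mxE !summxE mulr_sumr.
  by apply: eq_bigr => j _; rewrite mxE.
by apply: eq_bigr => j _; rewrite !tensmx_mul mul1mx mulmx1.
Qed.

(** A direct sum of semidefinite matrices is semidefinite, and a kernel vector
    of one summand is a kernel vector of the sum. *)
Lemma diag_point_boundary n (X : mxpoint R g n) (j0 : 'I_n) :
  is_diag_point X ->
  (forall j, j != j0 -> pd_set (generic_mx L 1) (diag_point X j)) ->
  psd_boundary (generic_mx L 1) (diag_point X j0) ->
  psd_boundary (generic_mx L n) X.
Proof.
move=> dX.
rewrite /pd_set /psd_boundary /mpolymx_at /= => hpd; rewrite !generic_mx_at.
have {hpd} hpd j : j != j0 -> psdmx (mxnc_eval L (diag_point X j)).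
  by move=> /hpd; rewrite generic_mx_at; apply: pdmxW.
move=> [psd0 /eqP /det0P [u u0 hu]].
pose T (j : 'I_n) : 'M[R]_(l * n, l * 1) := tensmx 1%:M (delta_mx j ord0).
pose T' (j : 'I_n) : 'M[R]_(l * 1, l * n) := tensmx 1%:M (delta_mx ord0 j).
have trT j : (T j)^T = T' j.
  by rewrite trmx_tens trmx1 trmx_delta.
have trT' j : (T' j)^T = T j by rewrite -trT trmxK.
have T'T j k : T' j *m T k = (j == k)%:R%:M.
  rewrite tensmx_mul mul1mx mul_delta_mx_cond.
  have [_|_] := eqVneq j k; last first.
    by rewrite tensmx0; apply/matrixP => a b; rewrite !mxE mul0rn.
  rewrite -[RHS]tensmx11; congr (tensmx _ _).
  by apply/matrixP => a b; rewrite !ord1 !mxE.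
have psd j : psdmx (mxnc_eval L (diag_point X j)).
  by have [->|/hpd] := eqVneq j j0.
split.
  split; first exact: monic_pencil_sym.
  move=> v; rewrite (diag_pencil_sum dX) mulmx_sumr mulmx_suml summxE.
  apply: sumr_ge0 => j _; have [_ /(_ (T' j *m v))] := psd j.
  by rewrite trmx_mul trT' !mulmxA.
apply/eqP/det0P; exists (u *m T' j0).
  apply: contra u0 => /eqP h.
  have e1 : T' j0 *m T j0 = 1%:M by rewrite T'T eqxx.
  by rewrite -(mulmx1 u) -e1 mulmxA h mul0mx.
rewrite (diag_pencil_sum dX) mulmx_sumr big1 // => j _.
rewrite -/(T j) -/(T' j) !mulmxA -(mulmxA u) T'T.
have [<-|_] := eqVneq j0 j; first by rewrite mulmx1 hu mul0mx.
by rewrite mul_mx_scalar scale0r !mul0mx.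
Qed.

End MonicPencil.

(** * The degree of a defining polynomial *)

Section DefiningDegree.
Variables (R : realType) (l g : nat) (L : mxncpoly R l l g).
Hypothesis monicL : monic_pencil L.

Theorem defining_degree_lower_bound (n d : nat) (p : mpoly (g * (n * n)) R) :
  (forall q, defining_poly (pencil_set L 1) q -> (d <= tdeg q)%N) ->
  defining_poly (pencil_set L n) p -> (n * d <= tdeg p)%N.
Proof.
move=> hd pdef.
(* q is p with all the off-diagonal variables set to 0. *)
pose D (s : 'I_(g * (n * n))) :=
  [exists i, exists j, s == mxvec_index i (mxvec_index j j)].
have Ddiag j s : D (diag_index j s).
  have [i ->] := point1_indexP s; rewrite diag_indexE.
  by apply/existsP; exists i; apply/existsP; exists j.
pose keep (X : 'I_(g * (n * n)) -> R) s := if D s then X s else 0.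
pose q : mpoly (g * (n * n)) R :=
  \sum_(u <- msupp p | [forall s, ~~ D s ==> (u s == 0%N)]) p@_u *: 'X_[u].
have qE X : q.@[X] = p.@[keep X].
  rewrite meval_sum mevalE big_mkcond; apply: eq_bigr => u _.
  rewrite mevalZ mevalX; case: ifPn => [/forallP h|].
    congr (_ * _); apply: eq_bigr => s _; rewrite /keep.
    by have := h s; case: (D s) => //= /eqP ->; rewrite !expr0.
  move=> /forallPn [s]; rewrite negb_imply => /andP[nD us].
  by rewrite (bigD1 s) //= /keep (negPf nD) expr0n (negPf us) mul0r mulr0.
have q0 : q != 0.
  apply/eqP => h; have := pdef.1; rewrite /mpoly_at.
  have -> : p.@[fun s => (0 : 'rV[R]__) ord0 s] = q.@[fun=> 0].
    by rewrite qE; apply: meval_eq => s; rewrite /keep mxE if_same.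
  by rewrite h meval0 ltxx.
have dq : (tdeg q <= tdeg p)%N.
  apply/tdeg_leP => u.
  by move=> /(@msupp_sum_ex _ _ _ _ _ _ id) [v vp [_ <-]]; apply: mdeg_le_tdeg.
apply: leq_trans dq.
pose S (x : 'I_(g * (1 * 1)) -> R) := psd_boundary (generic_mx L 1) (\row_s x s).
have sym1 := generic_sym monicL (n := 1); have star1 := generic_star monicL (n := 1).
apply: (@blocks_degree R _ _ n (@diag_index g n) S) => //.
- by move=> j i j' i' /diag_index_inj [].
- move=> f f0 fS; rewrite pencil_setE in hd.
  apply: (vanishing_poly_degree sym1 star1 hd f0) => x bx; apply: fS.
  by rewrite /S (_ : \row_s _ = x) //; apply/rowP => s; rewrite mxE.
move=> j X bX.
(* Moving the entries of the other blocks towards 0 brings the other summands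
   into the interior, and a polynomial in t that vanishes near 0 is 0. *)
pose J := [set diag_index j s | s : 'I_(g * (1 * 1))]%SET.
pose B := \row_s (if s \in J then X s else 0).
pose V := \row_s (if s \in J then 0 else X s).
have [P hP] := line_poly q B V.
suff P0 : P = 0.
  have := hP 1; rewrite P0 horner0 => /esym; rewrite -[RHS]/0 => <-.
  apply: meval_eq => s; rewrite !mxE.
  by case: ifP; rewrite ?mulr0 ?addr0 ?add0r ?mul1r.
have /nbhs_row [r r0 hr] : nbhs (0 : mxpoint R g 1) (pd_set (generic_mx L 1)).
  by apply: open_nbhs_nbhs; split; [exact: pd_set_open|exact: pd_set0].
pose K := \sum_s `|X s|.
have K0 : 0 <= K by apply: sumr_ge0 => i _; exact: normr_ge0.
have e0 : 0 < r / (1 + K) by rewrite divr_gt0 //; lra.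
apply: (poly_eq0_near (a := 0) e0) => t; rewrite subr0 => ht.
pose Z := \row_s keep (fun s => (B + t *: V) ord0 s) s.
have -> : P.[t] = mpoly_at p Z.
  by rewrite hP /mpoly_at qE; apply: meval_eq => s; rewrite [RHS]mxE.
have Zdiag : is_diag_point Z.
  move=> i a b ab; rewrite mxtupleE mxE /keep ifF //; apply/existsP => -[i'].
  move=> /existsP [j' /eqP /mxvec_index_inj [_ /mxvec_index_inj [ea eb]]].
  by move: ab; rewrite ea eb eqxx.
have ZE k s : diag_point Z k ord0 s
    = if k == j then X (diag_index j s) else t * X (diag_index k s).
  rewrite !mxE /keep Ddiag !mxE.
  have -> : (diag_index k s \in J) = (k == j).
    apply/imsetP/eqP => [[s' _ /diag_index_inj [->]]//|->]; by exists s.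
  by case: eqP => [->|_]; rewrite ?mulr0 ?addr0 ?add0r.
rewrite pencil_setE // in pdef.
apply: (defining_poly_boundary (generic_star monicL (n := n)) pdef).
apply: (diag_point_boundary monicL (j0 := j)) => //.
- move=> k kj; apply: hr => s; rewrite ZE (negPf kj) mxE subr0 normrM.
  apply: le_lt_trans (_ : `|t| * K < _).
    apply: ler_wpM2l => //; rewrite /K (bigD1 (diag_index k s)) //= lerDl.
    by apply: sumr_ge0 => i _; exact: normr_ge0.
  move: ht; rewrite ltr_pdivlMr; last lra.
  by have := normr_ge0 t; lra.
- rewrite (_ : diag_point Z j = \row_s X (diag_index j s)) //.
  by apply/rowP => s; rewrite ZE eqxx mxE.
Qed.

End DefiningDegree.

Lemma set_degP (R : realType) (m : nat) (C : set 'rV[R]_m) (p : mpoly m R) :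
  defining_poly C p ->
  exists2 q, min_degree_defining_poly C q & set_deg C = tdeg q.
Proof.
move=> hp; pose P k := `[< exists2 q, defining_poly C q & tdeg q = k >].
have Pex : exists k, P k by exists (tdeg p); apply/asboolP; exists p.
suff /(xgetPex 0%N) [q hq e] :
    exists d, [set d | exists2 q, min_degree_defining_poly C q & d = tdeg q] d.
  by exists q.
case: (ex_minnP Pex) => k /asboolP [q hq qk] kmin; exists k, q => //.
by split=> // q' hq'; rewrite qk; apply: kmin; apply/asboolP; exists q'.
Qed.

Lemma set_deg_min (R : realType) (m : nat) (C : set 'rV[R]_m) (p : mpoly m R) :
  min_degree_defining_poly C p -> set_deg C = tdeg p.
Proof.
move=> [hp pmin]; have [q [hq qmin] ->] := set_degP hp.
by apply/eqP; rewrite eqn_leq pmin ?qmin.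
Qed.

(** * Zeros of the vanishing ideal *)

Section ZeroClosure.
Variables (R : realType) (l g : nat) (L : mxncpoly R l l g).
Hypothesis monicL : monic_pencil L.

Lemma map_generic_mx (k n : nat) (p : mxncpoly R k l g) (x : mxpoint R g n) :
  map_mx (meval (fun s => x ord0 s)) (generic_mx p n) = mxnc_eval p x.
Proof. by rewrite -generic_mx_at; apply/matrixP => i j; rewrite !mxE. Qed.

(** The polynomial p adj(L) vanishes at boundary points, as the columns of
    adj(L) lie in the kernel there; so det L divides it, and multiplying by L
    gives (det L) p = (det L) Q L. *)
Lemma vanishing_ideal_left_multiple (n : nat) (p : mxncpoly R 1 l g) :
  (0 < n)%N ->
  min_degree_defining_poly (pencil_set L n) (pencil_det L n) ->
  vanishing_ideal (detailed_boundary L) p ->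
  exists Q, generic_mx p n = Q *m generic_mx L n.
Proof.
move=> n0 hmin pI; rewrite pencil_setE // in hmin.
set A := generic_mx L n; set P := generic_mx p n.
have dvd a b : divides (\det A) ((P *m \adj A) a b).
  apply: (min_degree_det_divides (generic_sym monicL (n := n))
    (generic_star monicL (n := n)) hmin) => x [px dx].
  have dx0 : \det (mxnc_eval L x) = 0 by rewrite -dx /mpolymx_at generic_mx_at.
  have -> : mpoly_at ((P *m \adj A) a b) x
          = (mxnc_eval p x *m col b (\adj (mxnc_eval L x))) a ord0.
    have -> : mpoly_at ((P *m \adj A) a b) x
        = (map_mx (meval (fun s => x ord0 s)) (P *m \adj A)) a b by rewrite [RHS]mxE.
    by rewrite map_mxM map_mx_adj !map_generic_mx colE mulmxA -colE [RHS]mxE.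
  rewrite (pI n x (col b (\adj (mxnc_eval L x)))) ?mxE //; split=> /=.
    rewrite pencil_interiorE // closure_pd_set.
    - by move: px; rewrite /psd_set.
    - exact: generic_sym.
    - exact: generic_star.
  rewrite colE mulmxA mul_mx_adj dx0 -colE.
  by apply/matrixP => i j; rewrite !mxE mul0rn.
pose Q := \matrix_(a, b) projT1 (cid (dvd a b)).
have eQ : P *m \adj A = \det A *: Q.
  apply/matrixP => a b; rewrite [RHS]mxE [Q a b]mxE; case: cid => c /= ->.
  by rewrite mulrC.
have dA0 : \det A != 0 by exact: (det_mpoly_neq0 (generic_star monicL (n := n))).
exists Q; apply/matrixP => a b; apply: (mulfI dA0).
have : \det A *: P = \det A *: (Q *m A).
  by rewrite scalemxAl -eQ -mulmxA mul_adj_mx mul_mx_scalar.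
by move/matrixP/(_ a b); rewrite [LHS]mxE [RHS]mxE.
Qed.

Definition row_poly (i : 'I_l) : mxncpoly R 1 l g :=
  \sum_(w <- monalg.msupp L) monalg.mkmalgU w (row i (monalg.mcoeff w L)).

Lemma row_poly_eval (n : nat) (x : mxpoint R g n) i :
  mxnc_eval (row_poly i) x = tensmx (delta_mx ord0 i) 1%:M *m mxnc_eval L x.
Proof.
rewrite mxnc_eval_sum mxnc_evalE mulmx_sumr; apply: eq_bigr => w _.
by rewrite mxnc_evalU tensmx_mul mul1mx -rowE.
Qed.

(** One inclusion is the factorization p = Q L; for the other, the rows of L
    belong to the vanishing ideal. *)
Theorem zero_closure_pencil :
  (forall n, (0 < n)%N ->
     min_degree_defining_poly (pencil_set L n) (pencil_det L n)) ->
  forall n, (0 < n)%N -> zero_closure (detailed_boundary L) n = pencil_zeros L n.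
Proof.
move=> hmin n n0; apply/seteqP; split=> -[x v] /=.
  rewrite /zero_closure /pencil_zeros /= => h.
  have row0 i : tensmx (delta_mx ord0 i : 'rV[R]_l) 1%:M *m (mxnc_eval L x *m v) = 0.
    rewrite mulmxA -row_poly_eval; apply: h => k y w _ [_ hw].
    by rewrite row_poly_eval -mulmxA hw mulmx0.
  rewrite -[LHS]mul1mx -tensmx11.
  have -> : (1%:M : 'M[R]_l) = \sum_i delta_mx i ord0 *m (delta_mx ord0 i : 'rV_l).
    apply/matrixP => a b; rewrite summxE (bigD1 a) //= big1 ?addr0.
      by rewrite !mxE big_ord1 !mxE !eqxx mul1r eq_sym.
    by move=> i /negPf ia; rewrite mxE big_ord1 !mxE eq_sym ia mul0r.
  rewrite tensmx_sumr mulmx_suml big1 // => i _.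
  by rewrite -[1%:M]mulmx1 -tensmx_mul -mulmxA row0 mulmx0.
rewrite /zero_closure /pencil_zeros /= => h p pI.
have [Q eQ] := vanishing_ideal_left_multiple n0 (hmin n n0) pI.
have /(congr1 (map_mx (meval (fun s => x ord0 s)))) := eQ.
by rewrite map_mxM !map_generic_mx => ->; rewrite -mulmxA h mulmx0.
Qed.

(** The lower bound n d and the upper bound deg delta_n <= n d leave no room for
    defining polynomials of degree below deg delta_n. *)
Theorem sharp_degree_bound (d : nat) :
  (forall q, defining_poly (pencil_set L 1) q -> (d <= tdeg q)%N) ->
  (forall n, (0 < n)%N -> (tdeg (pencil_det L n) <= n * d)%N) ->
  (forall n : nat, (0 < n)%N ->
     set_deg (pencil_set L n) = (n * tdeg (pencil_det L 1))%N /\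
     min_degree_defining_poly (pencil_set L n) (pencil_det L n)) /\
  (forall n : nat, (0 < n)%N ->
     zero_closure (detailed_boundary L) n = pencil_zeros L n).
Proof.
move=> hd hdet.
have hmin n : (0 < n)%N ->
    min_degree_defining_poly (pencil_set L n) (pencil_det L n).
  move=> n0; split; first exact: pencil_det_defining.
  move=> q hq; apply: leq_trans (hdet n n0) _.
  exact: (defining_degree_lower_bound monicL hd hq).
have degE n : (0 < n)%N -> tdeg (pencil_det L n) = (n * d)%N.
  move=> n0; apply/eqP; rewrite eqn_leq hdet //=.
  apply: (defining_degree_lower_bound monicL hd).
  exact: pencil_det_defining.
split; last exact: zero_closure_pencil.
move=> n n0; split; last exact: hmin.
by rewrite (set_deg_min (hmin n n0)) !degE // mul1n.
Qed.

End ZeroClosure.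

(** * The free ball *)

Section FreeBall.
Variables (R : realType) (g : nat).
Local Notation L := (free_ball_pencil R g).

Lemma free_ball_coefE (w : word g) :
  monalg.mcoeff w L = 1%:M *+ (FMonom [::] == w)
    + \sum_(i < g) delta_mx ord0 (lift ord0 i) *+ (FMonom [:: (i, true)] == w)
    + \sum_(i < g) delta_mx (lift ord0 i) ord0 *+ (FMonom [:: (i, false)] == w).
Proof.
have coef_sum (p : mxncpoly R g.+1 g.+1 g) (F1 F2 : 'I_g -> mxncpoly R g.+1 g.+1 g) :
    monalg.mcoeff w (p + \sum_(i < g) F1 i + \sum_(i < g) F2 i)
    = monalg.mcoeff w p + \sum_(i < g) monalg.mcoeff w (F1 i)
      + \sum_(i < g) monalg.mcoeff w (F2 i).
  have sumE F : monalg.mcoeff w (\sum_(i < g) F i)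
      = \sum_(i < g) monalg.mcoeff w (F i) :=
    big_morph (monalg.mcoeff w) (monalg.mcoeffD w) (monalg.mcoeff0 w) _ _ F.
  by rewrite (monalg.mcoeffD w (p + _)) (monalg.mcoeffD w p) !sumE.
apply: etrans (coef_sum _ _ _) _; congr (_ + _ + _).
- exact: monalg.mcoeffU.
- by apply: eq_bigr => i _; exact: monalg.mcoeffU.
- by apply: eq_bigr => i _; exact: monalg.mcoeffU.
Qed.

Lemma free_ball_coef_fdeg (w : word g) i j :
  monalg.mcoeff w L i j != 0 -> (fdeg w <= (i == ord0) + (j == ord0))%N.
Proof.
apply: contraR; rewrite -ltnNge fdegE => wij.
have ne (v : word g) (A : 'M[R]_g.+1) :
    (v = w -> A i j = 0) -> (A *+ (v == w)) i j = 0.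
  by rewrite mulmxnE; case: eqP => [h /(_ h) ->|]; rewrite ?mul0rn ?mulr0n.
apply/eqP; rewrite free_ball_coefE mxE [X in X + _]mxE !summxE ne; last first.
  by move=> e; move: wij; rewrite -e.
rewrite add0r !big1 ?addr0 // => k _; apply: ne => e; move: wij; rewrite -e /= mxE.
  by case: (j == _); case: (i == ord0); case: (j == ord0); rewrite ?andbF.
by case: (i == _); case: (i == ord0); case: (j == ord0); rewrite ?andbF.
Qed.

Lemma free_ball_monic : monic_pencil L.
Proof.
split.
- have star_sum (p : mxncpoly R g.+1 g.+1 g)
      (F1 F2 : 'I_g -> mxncpoly R g.+1 g.+1 g) :
      mxnc_star (p + \sum_(i < g) F1 i + \sum_(i < g) F2 i)
      = mxnc_star p + \sum_(i < g) mxnc_star (F2 i) + \sum_(i < g) mxnc_star (F1 i).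
    by rewrite (mxnc_starD (p + _)) (mxnc_starD p) addrAC !mxnc_star_sum.
  apply: etrans (star_sum _ _ _) _; rewrite [RHS]/free_ball_pencil.
  refine (congr2 +%R (congr2 +%R _ _) _).
  + by apply: etrans (mxnc_starU _ _) _; rewrite trmx1.
  + by apply: eq_bigr => i _; apply: etrans (mxnc_starU _ _) _; rewrite trmx_delta.
  + by apply: eq_bigr => i _; apply: etrans (mxnc_starU _ _) _; rewrite trmx_delta.
- move=> w; rewrite -mcoeff_neq0; apply: contraR; rewrite -ltnNge fdegE => w1.
  have ne (v : word g) (A : 'M[R]_g.+1) : (size v <= 1)%N -> A *+ (v == w) = 0.
    by case: eqP => // -> ; rewrite leqNgt w1.
  apply/eqP; rewrite free_ball_coefE ne // add0r.
  by rewrite !big1 ?addr0 // => i _; apply: ne.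
- rewrite mxnc_eval_at0 (_ : monalg.mcoeff _ L = 1%:M); first exact: tensmx11.
  have ne (a : letter g) (A : 'M[R]_g.+1) :
    A *+ (FMonom [:: a] == FMonom [::]) = 0 by case: eqP.
  by rewrite free_ball_coefE eqxx !big1 ?addr0 // => i _; apply: ne.
Qed.

Lemma free_ball_eval n (X : mxpoint R g n) :
  mxnc_eval L X = tensmx 1%:M 1%:M
    + \sum_(i < g) tensmx (delta_mx ord0 (lift ord0 i)) (mxtuple X i)^T
    + \sum_(i < g) tensmx (delta_mx (lift ord0 i) ord0) (mxtuple X i).
Proof.
have eval_sum (p : mxncpoly R g.+1 g.+1 g) (F1 F2 : 'I_g -> mxncpoly R g.+1 g.+1 g) :
    mxnc_eval (p + \sum_(i < g) F1 i + \sum_(i < g) F2 i) X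
    = mxnc_eval p X + \sum_(i < g) mxnc_eval (F1 i) X
      + \sum_(i < g) mxnc_eval (F2 i) X.
  by rewrite (mxnc_evalD X (p + _)) (mxnc_evalD X p) !mxnc_eval_sum.
apply: etrans (eval_sum _ _ _) _; congr (_ + _ + _).
- exact: mxnc_evalU.
- apply: eq_bigr => i _; apply: etrans (mxnc_evalU _ _ _) _.
  by rewrite /word_eval /= mulmx1.
- apply: eq_bigr => i _; apply: etrans (mxnc_evalU _ _ _) _.
  by rewrite /word_eval /= mulmx1.
Qed.

Definition coord_point (i : 'I_g) : mxpoint R g 1 :=
  mxvec (\matrix_(k, c) (k == i)%:R).

Lemma coord_pointE i k : mxtuple (coord_point i) k = ((k == i)%:R)%:M.
Proof.
apply/matrixP => a b; rewrite mxtupleE mxvecE !mxE.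
by rewrite !ord1 eqxx mulr1n.
Qed.

Lemma qform_tens1 (k : nat) (A : 'M[R]_k) (b : R) (u : 'cV[R]_k) :
  qform (tensmx A (b%:M : 'M[R]_1)) (tensmx u (1%:M : 'M[R]_1)) = qform A u * b.
Proof.
have e : (tensmx u (1%:M : 'M[R]_1))^T *m tensmx A b%:M *m tensmx u 1%:M
       = tensmx (u^T *m A *m u) b%:M.
  by rewrite trmx_tens !tensmx_mul trmx1 mul1mx mulmx1.
have /(congr1 (fun M : 'M[R]_(1 * 1) => M ord0 ord0)) := e.
rewrite [RHS]mxE [X in _ * X]mxE !ord1 eqxx mulr1n; exact.
Qed.

(** With u = e_0 + s e_i, the quadratic form at the point t e_i takes the value
    1 + s^2 + 2 s t = - 2 for t = - 2 s. *)
Lemma free_ball_line_exterior i (s : R) : s ^+ 2 = 1 ->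
  exists v, qform (mxnc_eval L ((- 2 * s) *: coord_point i)) v < 0.
Proof.
move=> s2; pose u : 'cV[R]_g.+1 :=
  \col_k ((k == ord0)%:R + s * (k == lift ord0 i)%:R).
have u0 : u ord0 ord0 = 1.
  by rewrite mxE eqxx (_ : (ord0 == lift _ _) = false) // mulr0 addr0.
have uk k : u (lift ord0 k) ord0 = s * (k == i)%:R.
  by rewrite mxE (inj_eq lift_inj) (_ : (lift _ _ == ord0) = false) // add0r.
clearbody u.
have qdelta a b : qform (delta_mx a b) u = u a ord0 * u b ord0.
  rewrite qform_sum (bigD1 a) //= [X in _ + X]big1 => [|j /negPf ja].
    rewrite addr0 (bigD1 b) //= big1 => [|j /negPf jb].
      by rewrite addr0 mxE !eqxx mulr1.
    by rewrite mxE eqxx jb mulr0 mul0r.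
  by apply: big1 => c _; rewrite mxE ja mulr0 mul0r.
have qsum (F : 'I_g -> 'M[R]_(g.+1 * 1)) w :
    qform (\sum_k F k) w = \sum_k qform (F k) w.
  apply: (big_morph (fun A => qform A w)) => [A B|]; first exact: qformD.
  by rewrite /qform mulmx0 mul0mx mxE.
exists (tensmx u (1%:M : 'M[R]_1)).
have X_E k : mxtuple ((- 2 * s) *: coord_point i) k = (- 2 * s * (k == i)%:R)%:M.
  have -> : mxtuple ((- 2 * s) *: coord_point i) k
          = (- 2 * s) *: mxtuple (coord_point i) k.
    exact: (letter_evalZ (- 2 * s) (coord_point i) (k, false)).
  by rewrite coord_pointE scale_scalar_mx.
rewrite free_ball_eval !qformD !qsum qform_tens1 mulr1.
have sum_i (F : 'I_g -> R) : (forall k, k != i -> F k = 0) -> \sum_k F k = F i.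
  by move=> F0; rewrite (bigD1 i) //= big1 ?addr0.
rewrite (sum_i (fun k => qform (tensmx (delta_mx ord0 (lift ord0 k)) _^T) _)).
  rewrite (sum_i (fun k => qform (tensmx (delta_mx (lift ord0 k) ord0) _) _)).
    rewrite X_E tr_scalar_mx !qform_tens1 !qdelta u0 uk eqxx !mulr1 mul1r.
    rewrite qform1 big_ord_recl u0 expr1n sum_i.
      by rewrite uk eqxx mulr1; nra.
    by move=> k /negPf ki; rewrite uk ki mulr0 expr0n.
  by move=> k /negPf ki; rewrite X_E qform_tens1 ki !mulr0.
by move=> k /negPf ki; rewrite X_E tr_scalar_mx qform_tens1 ki !mulr0.
Qed.

(** The line through a coordinate vector leaves the ball on both sides of 0, so
    that a defining polynomial, which is positive at 0, has two roots on it. *)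
Lemma free_ball_defining_degree (i : 'I_g) q :
  defining_poly (pencil_set L 1) q -> (2 <= tdeg q)%N.
Proof.
move=> qdef; have monicL := free_ball_monic.
rewrite pencil_setE // in qdef; pose e := coord_point i.
have sym1 := generic_sym monicL (n := 1); have star1 := generic_star monicL (n := 1).
have crossing (s : R) : s ^+ 2 = 1 ->
    exists2 t, 0 < t & psd_boundary (generic_mx L 1) ((- 2 * s * t) *: e).
  move=> s2; have [v hv] := free_ball_line_exterior i s2.
  apply: contrapT => none.
  have := connected_sub_pd_set sym1
    (@segment_set_connected R _ 0 ((- 2 * s) *: e)) (segment_set_l _ _)
    (pd_set0 star1) _ (segment_set_r _ _).
  move=> /(_ _) h; suff : pd_set (generic_mx L 1) ((- 2 * s) *: e).
    move=> /pdmxW [_ /(_ v)]; rewrite -[X in 0 <= X]/(qform _ _).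
    by rewrite /mpolymx_at generic_mx_at leNgt hv.
  apply: h => _ [t + <-] b; rewrite /= in_itv /= => /andP[t0 t1].
  have tE : 0 + t *: ((- 2 * s) *: e - 0) = (- 2 * s * t) *: e.
    by rewrite subr0 add0r scalerA mulrC.
  apply: none; exists t; last by rewrite -tE.
  rewrite lt_neqAle t0 andbT; apply/eqP => t0'; move: b; rewrite -t0' scale0r addr0.
  by have [_] := (pd_setE _ _).1 (pd_set0 star1).
have [t1 t10 b1] := crossing 1 (expr1n _ _).
have [|t2 t20 b2] := crossing (-1); first by rewrite sqrrN expr1n.
have [P sP PE] := ray_poly q e.
have root t : psd_boundary (generic_mx L 1) (t *: e) -> root P t.
  by move=> b; apply/rootP; rewrite PE (defining_poly_boundary star1 qdef b).
have P0 : P != 0.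
  apply/eqP => h; have := qdef.1; rewrite -[0 : 'rV[R]__](scale0r e) -PE h horner0.
  by rewrite ltxx.
rewrite -ltnS; apply: leq_trans sP.
apply: (@max_poly_roots _ P [:: - 2 * 1 * t1; - 2 * -1 * t2]) => //=.
  by rewrite !root.
by rewrite inE andbT; apply/eqP; lra.
Qed.

End FreeBall.

(** Without variables (g = 0), all polynomials are constant and d = 0; otherwise
    d = 2. *)
Lemma free_ball_sharp (R : realType) (g : nat) :
  exists2 d, (forall q, defining_poly (pencil_set (free_ball_pencil R g) 1) q ->
                (d <= tdeg q)%N) &
    forall n, (tdeg (pencil_det (free_ball_pencil R g) n) <= n * d)%N.
Proof.
case: g => [|g].
  exists 0%N => // n.
  apply: leq_trans (tdeg_pencil_det_le (r := fun=> 0%N) (c := fun=> 0%N) n _) _.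
    by move=> [[|[[]]]] //.
  by rewrite !big1.
exists 2 => [q|n]; first exact: (free_ball_defining_degree ord0).
apply: leq_trans (tdeg_pencil_det_le (r := fun i => (i == ord0) : nat)
  (c := fun i => (i == ord0) : nat) n (@free_ball_coef_fdeg R g.+1)) _.
have -> : (\sum_(i < g.+2) (i == ord0) = 1)%N; last by [].
by rewrite (bigD1 ord0) //= big1 // => i /negPf ->.
Qed.

Theorem corollary5p5 (R : realType) (g : nat) :
  (forall (l : nat) (L : mxncpoly R l l g), monic_pencil L ->
     (forall n : nat, (0 < n)%N ->
        [/\ (tdeg (pencil_det L n) >= set_deg (pencil_set L n))%N,
            (set_deg (pencil_set L n) >= n * set_deg (pencil_set L 1))%N &
            min_degree_defining_poly (pencil_set L 1) (pencil_det L 1) ->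
            (set_deg (pencil_set L n) >= n * tdeg (pencil_det L 1))%N]) /\
     (min_degree_defining_poly (pencil_set L 1) (pencil_det L 1) ->
      tdeg (pencil_det L 1) = l ->
      (forall n : nat, (0 < n)%N ->
         set_deg (pencil_set L n) = (n * tdeg (pencil_det L 1))%N /\
         min_degree_defining_poly (pencil_set L n) (pencil_det L n)) /\
      (forall n : nat, (0 < n)%N ->
         zero_closure (detailed_boundary L) n = pencil_zeros L n))) /\
  (let L := free_ball_pencil R g in
   (forall n : nat, (0 < n)%N ->
      set_deg (pencil_set L n) = (n * tdeg (pencil_det L 1))%N /\
      min_degree_defining_poly (pencil_set L n) (pencil_det L n)) /\
   (forall n : nat, (0 < n)%N ->
      zero_closure (detailed_boundary L) n = pencil_zeros L n)).
Proof.
split; last first.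
  have [d hd hdet] := free_ball_sharp R g.
  exact: (sharp_degree_bound (free_ball_monic R g) hd).
move=> l L monicL; split=> [n n0|hmin1 hl].
  have [q1 [_ min1] e1] := set_degP (pencil_det_defining monicL 1).
  have [qn [defn minn] en] := set_degP (pencil_det_defining monicL n).
  have lower : (n * set_deg (pencil_set L 1) <= set_deg (pencil_set L n))%N.
    by rewrite en e1; exact: (defining_degree_lower_bound monicL min1 defn).
  split=> //; first by rewrite en; apply/minn/pencil_det_defining.
  by move=> /set_deg_min <-.
apply: (sharp_degree_bound monicL (d := l)).
  by move=> q hq; rewrite -hl; apply: hmin1.2.
move=> n n0; apply: leq_trans
  (tdeg_pencil_det_le (r := fun=> 1%N) (c := fun=> 0%N) n _) _.
  move=> w i j wij; case: monicL => _ + _; apply; rewrite -mcoeff_neq0.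
  by apply: contraNneq wij => ->; rewrite mxE.
by rewrite sum1_card card_ord big1 ?addn0.
Qed.
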